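(* Let $(X_n)_{n\ge0}$ be a transient nearest neighbour random walk on the directed cover $\mathcal{T}$ of $G$ with transition data $p_G(i,j)$, $p(-i)$, whose non-zero transition probabilities are bounded away from $0$: there is $\varepsilon_0>0$ with $p(x,y)\ge\varepsilon_0$ for all $x,y\in\mathcal{T}$ with $p(x,y)>0$. Assume that the Markov chain on $G$ with transition matrix $Q=(q(i,j))_{i,j\in G}$, $q(i,j)=\frac{1-F(-j)}{1-F(-i)}\,p(i,j)\,\overline{G}_i(1)$, is positive recurrent with invariant probability measure $\nu$, and that the spectral radius of $(X_n)$ is strictly smaller than $1$. Let $\ell_0=\lim_{n\to\infty}|X_n|/n$ (a.s.) be the rate of escape with respect to the natural graph metric, and let $\pi_n$ be the distribution of $X_n$. Then the asymptotic entropy $h=\lim_{n\to\infty}-\frac1n\mathbb{E}[\log\pi_n(X_n)]$ exists and satisfies $$h=\ell_0\sum_{i,j\in G}-\nu(i)q(i,j)\log q(i,j)>0.$$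
   Context: $G$ is a countable directed graph, strongly connected, of bounded geometry (uniformly bounded vertex degrees), without multiple edges; $i_0\in G$. The directed cover $\mathcal{T}$ of $G$ rooted in $i_0$ is the rooted tree with vertices labelled by $\tau:\mathcal{T}\to G$: the root $o$ has label $i_0$, and recursively a vertex with label $i$ has exactly one direct descendant with label $j$ for each edge $(i,j)$ of $G$ and no others. $x^-$ denotes the direct ancestor of $x\neq o$, and $|x|$ the graph distance from $o$ to $x$. Given are transition probabilities $p_G(i,j)$ on $G$ (stochastic, with $p_G(i,j)>0$ iff there is an edge from $i$ to $j$) and backward probabilities $p(-i)\in(0,1)$, $i\in G$, such that for some $\varepsilon\in(0,1)$, $\varepsilon<p(-i)<1-\varepsilon$ for all $i$. Put $p(i,j)=(1-p(-i))p_G(i,j)$. A loop is added at the root. The random walk $(X_n)$ on $\mathcal{T}$ starts at $o$ and has transition probabilities $p(x,y)=p(\tau(x),\tau(y))$ if $y^-=x$; $p(x,x^-)=p(-\tau(x))$ for $x\ne o$; $p(o,o)=p(-i_0)$; and $0$ otherwise. For $i\in G$ and any $x\in\mathcal{T}\setminus\{o\}$ with $\tau(x)=i$ (the choice is irrelevant), $F(-i)=\mathbb{P}[\exists n:\ X_n=x^-\mid X_0=x]$ and $\overline{G}_i(1)=\sum_{n\ge0}\mathbb{P}[X_n=x,\ X_m\neq x^-\ \forall m<n\mid X_0=x]$. The spectral radius of $(X_n)$ is $1/R$, where $R$ is the radius of convergence of $G(o,o|z)=\sum_{n\ge0}\mathbb{P}[X_n=o\mid X_0=o]z^n$. Convention: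 $0\log 0=0$.
   Formalization: The strict inequality h>0 is asserted only when some vertex of G has at least two distinct out-neighbours; if G is a directed cycle (or a single vertex with a loop) the cover is a ray and h=0, so h>0 fails there. *)

(* Defs.v *)
From HB Require Import structures.
From mathcomp Require Import all_boot all_order all_algebra.
From mathcomp Require Import all_classical all_reals all_analysis.
Set Implicit Arguments.
Unset Strict Implicit.
Unset Printing Implicit Defensive.
Import Order.TTheory GRing.Theory Num.Theory.
Import numFieldNormedType.Exports.
Local Open Scope classical_set_scope.
Local Open Scope ring_scope.

Section digraphs.
Variables (G : countType) (E : rel G).

Definition strongly_connected : Prop :=
  forall i j, exists2 s : seq G, path E i s & last i s = j.

(* The degree of a vertex counts its outgoing and its incoming edges. *)
Definition bounded_geometry : Prop :=
  exists D : nat, forall i, exists2 s : seq G, (size s <= D)%N &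
    forall j, E i j || E j i -> j \in s.

End digraphs.

Section directed_cover.
Variables (G : countType) (E : rel G) (i0 : G).

(* A vertex of the directed cover is a finite directed path of the graph that
   starts at i0, given by the list of the vertices visited after i0. The root
   is the empty path; the children of a path are its one-edge extensions, and
   its label is its endpoint. *)
Definition dcover : Type := {s : seq G | path E i0 s}.
HB.instance Definition _ := Countable.on dcover.

Definition cover_root : dcover := exist (fun s => path E i0 s) [::] isT.
Definition tau (x : dcover) : G := last i0 (val x).

(* The direct ancestor; the junk value at the root is the root itself. *)
Definition parent (x : dcover) : dcover :=
  exist (fun s => path E i0 s) _ (take_path (size (val x)).-1 (valP x)).

Definition is_child (x y : dcover) : bool := (y != cover_root) && (parent y == x).

(* The distance to the root: see level_le and level_attained below. *)
Definition level (x : dcover) : nat := size (val x).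

Definition adjacent (x y : dcover) : bool := is_child x y || is_child y x.

Lemma cover_root_level x : (x == cover_root) = (level x == 0)%N.
Proof. by rewrite -val_eqE /level size_eq0. Qed.

Lemma level_parent x : level (parent x) = (level x).-1.
Proof.
rewrite /level size_take; case: (size (val x)) => //= n.
by rewrite ltnSn.
Qed.

Lemma level_child x y : is_child x y -> level y = (level x).+1.
Proof.
case/andP; rewrite cover_root_level => y0 /eqP <-.
by rewrite level_parent prednK // lt0n.
Qed.

Lemma level_le (s : seq dcover) :
  path adjacent cover_root s -> (level (last cover_root s) <= size s)%N.
Proof.
suff H x : path adjacent x s -> (level (last x s) <= level x + size s)%N.
  exact: H.
elim: s x => [x _|y s IH x] /=; first by rewrite addn0.
case/andP=> xy /IH /leq_trans; apply; rewrite addnS -addSn leq_add2r.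
by case/orP: xy => /level_child ->; rewrite ?leqnn // leqW // leqnSn.
Qed.

Lemma level_attained x : exists s : seq dcover,
  [/\ path adjacent cover_root s, last cover_root s = x & size s = level x].
Proof.
have [n] := ubnP (level x); elim: n x => // n IH x.
have [x0 _|x0 xn] := boolP (x == cover_root).
  by exists [::]; split=> //; [exact/esym/eqP|move: x0; rewrite cover_root_level => /eqP].
have x1 : (0 < level x)%N by rewrite lt0n -cover_root_level.
have [|s [ps ls ss]] := IH (parent x).
  by rewrite level_parent; case: (level x) xn x1.
exists (rcons s x); split.
- by rewrite rcons_path ps ls /adjacent /is_child x0 eqxx.
- by rewrite last_rcons.
- by rewrite size_rcons ss level_parent prednK.
Qed.

(* Every label of a strongly connected graph with at least one edge occurs away
   from the root; quantities that depend only on the label of x are evaluated at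
   this representative. *)
Definition repr_vertex (i : G) : dcover :=
  xget cover_root [set x : dcover | x != cover_root /\ tau x = i].

End directed_cover.

Section markov_chains.
Variables (R : realType).

(* A family of laws (P_x), one for each starting point x, on a common space
   carrying the process: [P x] is the law given X_0 = x. *)
Definition markov_chain (S : choiceType) (p : S -> S -> R) d
    (Omega : measurableType d) (P : S -> probability Omega R)
    (X : nat -> Omega -> S) : Prop :=
  (forall n x, measurable [set w | X n w = x]) /\
  (forall x n (s : nat -> S),
     P x [set w | forall k, (k <= n)%N -> X k w = s k] =
     ((s 0%N == x)%:R * \prod_(k < n) p (s k) (s k.+1))%:E).

Definition transient (S : Type) d (Omega : measurableType d)
    (P : S -> probability Omega R) (X : nat -> Omega -> S) : Prop :=
  forall x, (P x [set w | exists2 n, (0 < n)%N & X n w = x] < 1)%E.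

Definition stochastic (S : choiceType) (q : S -> S -> R) : Prop :=
  (forall i j, 0 <= q i j) /\
  (forall i, (\esum_(j in [set: S]) (q i j)%:E = 1)%E).

(* [first_passage q j n i] is the probability that the chain with transition
   matrix q started at i visits j at time n and at no time 0 < m < n (n > 0). *)
Fixpoint first_passage (S : choiceType) (q : S -> S -> R) (j : S) (n : nat)
    (i : S) : \bar R :=
  match n with
  | 0%N => 0%E
  | 1%N => (q i j)%:E
  | m.+1 => (\esum_(k in [set k | k != j]) ((q i k)%:E * first_passage q j m k))%E
  end.

(* Almost sure return to each state, with finite mean return time. *)
Definition positive_recurrent (S : choiceType) (q : S -> S -> R) : Prop :=
  forall i, (\sum_(0 <= n <oo) first_passage q i n i = 1)%E /\
            (\sum_(0 <= n <oo) (n%:R%:E * first_passage q i n i) < +oo)%E.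

Definition invariant_probability (S : choiceType) (q : S -> S -> R)
    (nu : S -> R) : Prop :=
  [/\ forall i, 0 <= nu i,
      (\esum_(i in [set: S]) (nu i)%:E = 1)%E &
      forall j, (\esum_(i in [set: S]) (nu i * q i j)%:E = (nu j)%:E)%E].

Definition convergence_radius (a : nat -> R) : \bar R :=
  ereal_sup [set r%:E | r in [set r : R | 0 <= r /\ cvgn (pseries a r)]].

Definition law_at (S : Type) d (Omega : measurableType d)
    (P : S -> probability Omega R) (X : nat -> Omega -> S) (x : S) (n : nat)
    (y : S) : R :=
  fine (P x [set w | X n w = y]).

Definition spectral_radius (S : Type) d (Omega : measurableType d)
    (P : S -> probability Omega R) (X : nat -> Omega -> S) (o : S) : \bar R :=
  ((convergence_radius (fun n => law_at P X o n o))^-1)%E.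

End markov_chains.

Section cover_walk.
Variables (R : realType) (G : countType) (E : rel G) (i0 : G).
Variables (pG : G -> G -> R) (pback : G -> R).
Local Notation T := (dcover E i0).

Definition pfwd (i j : G) : R := (1 - pback i) * pG i j.

Definition walk_kernel (x y : T) : R :=
  if is_child x y then pfwd (tau x) (tau y)
  else if is_child y x then pback (tau x)
  else if (x == cover_root E i0) && (y == cover_root E i0) then pback i0
  else 0.

Variables (d : measure_display) (Omega : measurableType d).
Variables (P : T -> probability Omega R) (X : nat -> Omega -> T).

(* F(-i) *)
Definition Fback (i : G) : R :=
  let x := repr_vertex E i0 i in
  fine (P x [set w | exists n, X n w = parent x]).

(* The value at 1 of the Green function of the walk killed at the ancestor. *)
Definition Gbar (i : G) : R :=
  let x := repr_vertex E i0 i in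
  fine (\sum_(0 <= n <oo)
    P x [set w | X n w = x /\ forall m, (m < n)%N -> X m w <> parent x])%E.

Definition exit_kernel (i j : G) : R :=
  (1 - Fback j) / (1 - Fback i) * pfwd i j * Gbar i.

End cover_walk.

(* Main.v *)
Require Import Defs.
From mathcomp Require Import all_boot all_order all_algebra finmap.
From mathcomp Require Import all_classical all_reals all_analysis.
From mathcomp Require Import ring lra zify.
Set Implicit Arguments.
Unset Strict Implicit.
Unset Printing Implicit Defensive.
Import Order.TTheory GRing.Theory Num.Theory.
Import numFieldNormedType.Exports.
Local Open Scope classical_set_scope.
Local Open Scope ring_scope.

(** Write anc_L x for the ancestor of x at level L. Only finite-time entropies
    are compared. Outside an event whose probability tends to 0, |X_m| is close
    to m * ell0 for all m >= n; then, for L slightly below n * ell0 and every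
    N >= n, X_n and X_N have the same ancestor at level L and X_n is within o(n)
    of it. Encoding one of X_n and anc_L X_N given the other therefore costs
    o(n), so H(X_n) and H(anc_L X_N) differ by o(n). As N tends to infinity the
    law of anc_L X_N converges to the law of the level-L vertex of the limiting
    ray. Last-exit decompositions show that the labels along this ray form a
    Markov chain with transition matrix Q, and the chain rule for entropy
    combined with the ergodic theorem for Q gives the entropy at level L as
    L * (entropy rate of Q) + o(L). A spectral radius smaller than 1 makes the
    Green functions finite and forces ell0 > 0. *)

(** * Entropy *)

(** A fallback code whose length is linear in the level serves every vertex, so the bad event costs
    at most a constant times [n] times its probability; this controls expectations directly. The
    error terms of the comparison do not depend on [N]: this is why the bad event involves all times
    after [n], and why [N] can tend to infinity with [n] and [L] fixed. The limit law of the
    ancestor comes from a mass balance: the mass of a subtree at time [N] is the inflow minus the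
    outflow through a single edge, and both are partial Green sums. The labels along the ray do not
    start from [nu], so the ergodic theorem must hold from every starting label. It is proved for
    Cesàro averages, as Q may be periodic, by showing that their [nu]-weighted Dirichlet form tends
    to 0. The inequality F(-i) < 1, which keeps the denominators of Q away from 0, is drawn from
    positive recurrence. For [ell0 > 0], the exponential decay of return probabilities beats the
    exponential growth of balls whose radius is a small enough fraction of the time. *)

Section entropy_function.
Variable R : realType.
Implicit Types (t : R).

Definition eta t : R := - (t * ln t).

Lemma eta0 : eta 0 = 0. Proof. by rewrite /eta mul0r oppr0. Qed.

Lemma eta_ge0 t : 0 <= t <= 1 -> 0 <= eta t.
Proof.
move=> /andP[t0 t1]; rewrite /eta -mulrN mulr_ge0 // oppr_ge0.
by rewrite ln_le0.
Qed.

Lemma eta_gt0 t : 0 < t < 1 -> 0 < eta t.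
Proof.
by move=> /andP[t0 t1]; rewrite /eta -mulrN mulr_gt0 // oppr_gt0 ln_lt0 ?t0.
Qed.

(** Write [t = s^2]; then [ln (1 + u) <= u] at [u = 1/s - 1] bounds [- ln s]. The estimate controls
    [eta] near 0, where continuity of [ln] is of no help. *)
Lemma eta_le_sqrt t : 0 <= t -> eta t <= 2 * Num.sqrt t.
Proof.
rewrite le_eqVlt => /predU1P[<-|t0]; first by rewrite eta0 sqrtr0 mulr0.
set s := Num.sqrt t; have s0 : 0 < s by rewrite sqrtr_gt0.
have ts : t = s ^+ 2 by rewrite sqr_sqrtr // ltW.
have sV0 : 0 < s^-1 by rewrite invr_gt0.
have := @le_ln1Dx R (s^-1 - 1); rewrite addrCA subrr addr0 lnV ?posrE // => H.
have {}H : - ln s <= s^-1 - 1 by apply: H; rewrite ltrBrDr addrC subrr.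
have -> : eta t = 2 * (s ^+ 2 * (- ln s)).
  by rewrite /eta ts lnXn // mulrN mulrnAr -mulr_natl mulrN.
rewrite ler_pM2l //.
have : s ^+ 2 * (- ln s) <= s ^+ 2 * (s^-1 - 1).
  by rewrite ler_pM2l // exprn_gt0.
move=> /le_trans; apply.
rewrite mulrBr mulr1 expr2 -mulrA divff ?gt_eqF // mulr1.
by rewrite gerBl mulr_ge0 // ltW.
Qed.

Lemma eta_le2 t : 0 <= t <= 1 -> eta t <= 2.
Proof.
move=> /andP[t0 t1]; apply: (le_trans (eta_le_sqrt t0)).
by rewrite -[leRHS]mulr1 ler_pM2l // -sqrtr1 ler_wsqrtr.
Qed.

Lemma eta_cvg (u : R^nat) t : (forall n, 0 <= u n <= 1) ->
  u @ \oo --> t -> (eta \o u) @ \oo --> eta t.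
Proof.
move=> u0 ut.
have t0 : 0 <= t.
  have -> : t = lim (u @ \oo) by apply/esym/cvg_lim.
  by apply: limr_ge; [apply: cvgP ut|apply: nearW => n; case/andP: (u0 n)].
move: t0; rewrite le_eqVlt => /predU1P[t0|t0]; last first.
  apply: cvgN; apply: cvgM => //.
  by apply: (cvg_comp _ _ ut); apply: continuous_ln.
rewrite -t0 eta0 in ut *.
apply: (@squeeze_cvgr _ _ _ _ (fun=> 0) (fun n => 2 * Num.sqrt (u n))).
- apply: nearW => n /=; rewrite eta_ge0 ?u0 // eta_le_sqrt //.
  by case/andP: (u0 n).
- exact: cvg_cst.
- rewrite -[X in _ --> X](mulr0 2); apply: cvgM; first exact: cvg_cst.
  rewrite -[X in _ --> X](@sqrtr0 R).
  by apply: (cvg_comp _ _ ut); apply: sqrt_continuous.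
Qed.

(* Gibbs' inequality for the sub-probability [sum_a p(a) kappa(a, -)]. *)
Lemma entropy_coding (A B : eqType) (sA : seq A) (sB : seq B)
    (J kappa : A -> B -> R) :
  (forall a b, 0 <= J a b) -> (forall a b, 0 < kappa a b) ->
  \sum_(a <- sA) \sum_(b <- sB) J a b = 1 ->
  (forall a, a \in sA -> \sum_(b <- sB) kappa a b <= 1) ->
  \sum_(b <- sB) eta (\sum_(a <- sA) J a b) <=
  \sum_(a <- sA) eta (\sum_(b <- sB) J a b) -
  \sum_(a <- sA) \sum_(b <- sB) J a b * ln (kappa a b).
Proof.
move=> J0 k0 J1 k1.
pose p a := \sum_(b <- sB) J a b; pose m b := \sum_(a <- sA) J a b.
have p0 a : 0 <= p a by apply: sumr_ge0.
have m0 b : 0 <= m b by apply: sumr_ge0.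
have Jp a b : b \in sB -> J a b <= p a.
  by move=> bB; rewrite /p (big_rem b) //= lerDl; apply: sumr_ge0.
have Jm a b : a \in sA -> J a b <= m b.
  by move=> aA; rewrite /m (big_rem a) //= lerDl; apply: sumr_ge0.
(* This is [ln x <= x - 1] at [x = p a * kappa a b / m b], multiplied by [J a b]; the last bound
   uses [J a b <= m b]. Summed over all pairs, the right side is at most [1 - 1]. *)
have key a b : a \in sA -> b \in sB ->
    J a b * ln (p a) + J a b * ln (kappa a b) - J a b * ln (m b) <=
    p a * kappa a b - J a b.
  move=> aA bB; have := J0 a b; rewrite le_eqVlt => /predU1P[<-|Jab].
    by rewrite !mul0r !subr0 addr0 mulr_ge0 // ltW.
  have pa : 0 < p a by apply: lt_le_trans (Jp a b bB).
  have mb : 0 < m b by apply: lt_le_trans (Jm a b aA).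
  set x := p a * kappa a b / m b.
  have x0 : 0 < x by rewrite divr_gt0 // mulr_gt0.
  have lx : ln x = ln (p a) + ln (kappa a b) - ln (m b).
    by rewrite /x ln_div ?lnM ?posrE // ?mulr_gt0.
  have := @le_ln1Dx R (x - 1); rewrite addrCA subrr addr0 => H.
  have {}H : ln x <= x - 1 by apply: H; rewrite ltrBrDr addrC subrr.
  have -> : J a b * ln (p a) + J a b * ln (kappa a b) - J a b * ln (m b) =
      J a b * ln x by rewrite lx; ring.
  apply: (@le_trans _ _ (J a b * (x - 1))); first by rewrite ler_pM2l.
  rewrite mulrBr mulr1 lerB // /x mulrCA -[leRHS]mulr1.
  apply: ler_wpM2l; first by rewrite mulr_ge0 // ltW.
  by rewrite ler_pdivrMr // mul1r Jm.
have : \sum_(a <- sA) \sum_(b <- sB)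
   (J a b * ln (p a) + J a b * ln (kappa a b) - J a b * ln (m b)) <=
   \sum_(a <- sA) \sum_(b <- sB) (p a * kappa a b - J a b).
  rewrite big_seq [leRHS]big_seq ler_sum // => a aA.
  by rewrite big_seq [leRHS]big_seq ler_sum // => b bB; exact: key.
have -> : \sum_(a <- sA) \sum_(b <- sB)
   (J a b * ln (p a) + J a b * ln (kappa a b) - J a b * ln (m b)) =
   - (\sum_(a <- sA) eta (p a)) +
   (\sum_(a <- sA) \sum_(b <- sB) J a b * ln (kappa a b)) +
   \sum_(b <- sB) eta (m b).
  under eq_bigr => a _ do rewrite big_split big_split /=.
  rewrite big_split big_split /=; congr (_ + _ + _).
    rewrite -sumrN; apply: eq_bigr => a _.
    by rewrite -big_distrl /= /eta opprK.
  by rewrite exchange_big; apply: eq_bigr => b _; rewrite sumrN -big_distrl.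
have : \sum_(a <- sA) \sum_(b <- sB) (p a * kappa a b - J a b) <= 0.
  under eq_bigr => a _ do rewrite big_split /= sumrN -big_distrr /=.
  rewrite big_split /= sumrN J1 subr_le0 -[leRHS]J1.
  rewrite big_seq [leRHS]big_seq ler_sum // => a aA.
  by rewrite -[leRHS]mulr1 ler_wpM2l ?k1.
rewrite -/m -/p; lra.
Qed.

End entropy_function.

(** * Averages of a Markov chain with an invariant probability *)

Section esum_complements.
Variable R : realType.
Local Open Scope ereal_scope.

Lemma esum_seq (T : choiceType) (s : seq T) (f : T -> \bar R) :
  uniq s -> (forall x, 0 <= f x) -> (forall x, x \notin s -> f x = 0) ->
  \esum_(x in [set: T]) f x = \sum_(x <- s) f x.
Proof.
move=> us f0 fs.
have -> : \esum_(x in [set: T]) f x = \esum_(x in [set` s]) f x.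
  rewrite [RHS]esum_mkcond; apply: eq_esum => x _.
  case: ifPn => // xs; apply: fs; apply: contra xs => xs.
  by rewrite inE.
rewrite esum_fset //.
by rewrite -fsbig_seq.
Qed.

Lemma le_esumZ (T : choiceType) (c : R) (f : T -> \bar R) :
  (0 <= c)%R -> (forall x, 0 <= f x) ->
  \esum_(x in [set: T]) (c%:E * f x) <= c%:E * \esum_(x in [set: T]) f x.
Proof.
move=> c0 f0; apply: ge_ereal_sup => /= _ [X [finX _] <-].
rewrite -ge0_mule_fsumr //; apply: lee_wpmul2l; first by rewrite lee_fin.
by apply: ereal_sup_ubound; exists X.
Qed.

(** The reverse inequality is [le_esumZ] for the factor [c^-1] and the function [c * f]. *)
Lemma esumZ (T : choiceType) (c : R) (f : T -> \bar R) :
  (0 <= c)%R -> (forall x, 0 <= f x) ->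
  \esum_(x in [set: T]) (c%:E * f x) = c%:E * \esum_(x in [set: T]) f x.
Proof.
move=> c0 f0; apply/eqP; rewrite eq_le le_esumZ //=.
have [->|cn0] := eqVneq c 0%R.
  by rewrite mul0e esum_ge0 // => x _; rewrite mul0e.
have {c0 cn0}c0 : (0 < c)%R by rewrite lt_neqAle eq_sym cn0.
have cV : (0 <= c^-1)%R by rewrite invr_ge0 ltW.
have := @le_esumZ T c^-1 (fun x => c%:E * f x) cV.
under eq_esum do rewrite muleA -EFinM mulVf ?gt_eqF // mul1e.
move=> H.
rewrite -(@lee_pmul2l _ c^-1%:E) ?fin_numE // ?lte_fin ?invr_gt0 //.
by rewrite muleA -EFinM mulVf ?gt_eqF // mul1e; apply: H => x; rewrite mule_ge0 // lee_fin ltW.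
Qed.

Lemma esum_exchange (T1 T2 : choiceType) (f : T1 -> T2 -> \bar R) :
  (forall x y, 0 <= f x y) ->
  \esum_(x in [set: T1]) \esum_(y in [set: T2]) f x y =
  \esum_(y in [set: T2]) \esum_(x in [set: T1]) f x y.
Proof.
move=> f0; rewrite !esum_esum //.
rewrite (@reindex_esum _ _ _ ([set: T1] `*`` fun=> [set: T2])
  ([set: T2] `*`` fun=> [set: T1]) (fun z => (z.2, z.1))) //.
split=> [z _|[x y] [x' y'] _ _ [-> ->]|[x y] _] //=.
by exists (y, x).
Qed.

End esum_complements.

Section ergodic.
Variables (R : realType) (G : countType) (nb : G -> seq G).
Variables (q : G -> G -> R) (nu : G -> R).
Hypothesis q0 : forall i j, 0 <= q i j.
Hypothesis nb_uniq : forall i, uniq (nb i).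
Hypothesis q_nb : forall i j, j \notin nb i -> q i j = 0.
Hypothesis q1 : forall i, \sum_(j <- nb i) q i j = 1.
Hypothesis nu0 : forall i, 0 <= nu i.
Hypothesis nu1 : (\esum_(i in [set: G]) (nu i)%:E = 1)%E.
Hypothesis nuq : forall j, (\esum_(i in [set: G]) (nu i * q i j)%:E = (nu j)%:E)%E.
Hypothesis irr : forall i j, exists2 s : seq G,
  path (fun i j => 0 < q i j) i s & last i s = j.

(** [esum] is a supremum of finite sums, hence an integral against [nu] only for nonnegative [f];
    the arguments below are arranged to add and never to subtract. *)
Definition mean (f : G -> R) : \bar R :=
  (\esum_(i in [set: G]) (nu i * f i)%:E)%E.
Definition markov_step (f : G -> R) (i : G) : R := \sum_(j <- nb i) q i j * f j.

Lemma step_ge0 f : (forall i, 0 <= f i) -> forall i, 0 <= markov_step f i.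
Proof. by move=> f0 i; apply: sumr_ge0 => j _; rewrite mulr_ge0. Qed.

Lemma le_step f g : (forall i, f i <= g i) -> forall i, markov_step f i <= markov_step g i.
Proof. by move=> fg i; apply: ler_sum => j _; rewrite ler_wpM2l. Qed.

Lemma step_cst c i : markov_step (fun=> c) i = c.
Proof. by rewrite /markov_step -big_distrl /= q1 mul1r. Qed.

Lemma mean_ge0 f : (forall i, 0 <= f i) -> (0 <= mean f)%E.
Proof. by move=> f0; apply: esum_ge0 => i _; rewrite lee_fin mulr_ge0. Qed.

Lemma le_mean f g : (forall i, f i <= g i) -> (mean f <= mean g)%E.
Proof. by move=> fg; apply: le_esum => i _; rewrite lee_fin ler_wpM2l. Qed.

Lemma meanD f g : (forall i, 0 <= f i) -> (forall i, 0 <= g i) ->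
  mean (fun i => f i + g i) = (mean f + mean g)%E.
Proof.
move=> f0 g0; rewrite /mean -esumD.
- by apply: eq_esum => i _; rewrite mulrDr.
- by move=> i _; rewrite lee_fin mulr_ge0.
- by move=> i _; rewrite lee_fin mulr_ge0.
Qed.

Lemma meanZ c f : 0 <= c -> (forall i, 0 <= f i) ->
  mean (fun i => c * f i) = (c%:E * mean f)%E.
Proof.
move=> c0 f0; rewrite /mean -esumZ //; last first.
  by move=> i; rewrite lee_fin mulr_ge0.
by apply: eq_esum => i _; rewrite -EFinM mulrCA.
Qed.

Lemma mean_cst c : 0 <= c -> mean (fun=> c) = c%:E.
Proof.
move=> c0; have := @meanZ c (fun=> 1) c0 (fun=> ler01).
rewrite mulr1 => ->; rewrite /mean.
under eq_esum do rewrite mulr1.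
by rewrite nu1 mule1.
Qed.

Lemma mean_step f : (forall i, 0 <= f i) -> mean (markov_step f) = mean f.
Proof.
move=> f0; rewrite /mean.
transitivity (\esum_(i in [set: G]) \esum_(j in [set: G])
    (nu i * (q i j * f j))%:E)%E.
  apply: eq_esum => i _; rewrite (@esum_seq _ _ (nb i)) //.
  - by rewrite /markov_step big_distrr /= sumEFin.
  - by move=> j; rewrite lee_fin !mulr_ge0.
  - by move=> j /q_nb ->; rewrite mul0r mulr0.
rewrite esum_exchange; last by move=> i j; rewrite lee_fin !mulr_ge0.
apply: eq_esum => j _.
under eq_esum do rewrite mulrA mulrC EFinM.
by rewrite esumZ // ?nuq -?EFinM 1?mulrC // => i; rewrite lee_fin mulr_ge0.
Qed.

Lemma mean_fin f M : 0 <= M -> (forall i, 0 <= f i <= M) -> mean f \is a fin_num.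
Proof.
move=> M0 fM; have f0 i : 0 <= f i by case/andP: (fM i).
rewrite (ge0_fin_numE (mean_ge0 f0)).
apply: (@le_lt_trans _ _ (mean (fun=> M))); first by apply: le_mean => j; case/andP: (fM j).
by rewrite mean_cst ?ltry.
Qed.

(** Some state has positive mass because the total is 1; invariance carries positivity along each
    edge, and irreducibility reaches [i]. *)
Lemma nu_gt0 i : 0 < nu i.
Proof.
have [j nuj] : exists j, 0 < nu j.
  apply: contrapT => /forallNP nuN.
  have : (\esum_(i in [set: G]) (nu i)%:E = 0)%E.
    apply: esum1 => j _; congr EFin; apply/eqP; rewrite eq_le nu0 andbT leNgt.
    exact/negP.
  by rewrite nu1 => /eqP; rewrite onee_eq0.
have [s sp <-] := irr j i.
elim: s j nuj sp => //= k s IH j nuj /andP[qjk]; apply: IH.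
rewrite -lte_fin -nuq; apply: (@lt_le_trans _ _ (nu j * q j k)%:E).
  by rewrite lte_fin mulr_gt0.
rewrite [leRHS](esumID [set j]); last by move=> *; rewrite lee_fin mulr_ge0.
rewrite setTI esum_set1; last by rewrite lee_fin mulr_ge0.
by rewrite leeDl // esum_ge0 // => *; rewrite lee_fin mulr_ge0.
Qed.

Lemma le_mean_at f i : (forall i, 0 <= f i) -> ((nu i * f i)%:E <= mean f)%E.
Proof.
move=> f0; rewrite /mean (esumID [set i]); last first.
  by move=> *; rewrite lee_fin mulr_ge0.
rewrite setTI esum_set1; last by rewrite lee_fin mulr_ge0.
by rewrite leeDl // esum_ge0 // => *; rewrite lee_fin mulr_ge0.
Qed.

(** Cesàro means, because the powers of a periodic [q] need not converge. *)
Definition average (h : G -> R) (k : nat) (i : G) : R :=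
  k.+1%:R^-1 * \sum_(m < k.+1) iter m markov_step h i.

Section bounded.
Variables (h : G -> R) (M : R).
Hypothesis hM : forall i, 0 <= h i <= M.

Lemma iter_step_bound m i : 0 <= iter m markov_step h i <= M.
Proof.
elim: m i => // m IH i; rewrite iterS step_ge0 /=; last first.
  by move=> j; case/andP: (IH j).
by rewrite -(step_cst M i); apply: le_step => j; case/andP: (IH j).
Qed.

Lemma average_bound k i : 0 <= average h k i <= M.
Proof.
rewrite /average; apply/andP; split.
  rewrite mulr_ge0 ?invr_ge0 // sumr_ge0 // => m _.
  by case/andP: (iter_step_bound m i).
rewrite ler_pdivrMl // mulr_natl.
rewrite -[k.+1 in leRHS]card_ord -sumr_const ler_sum // => m _.
by case/andP: (iter_step_bound m i).
Qed.

(** Telescoping: the iterates [1..k+1] and [0..k] differ only in their end terms, so the average is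
    harmonic up to an error of order 1/k. *)
Lemma step_average k i : markov_step (average h k) i =
  average h k i + k.+1%:R^-1 * (iter k.+1 markov_step h i - h i).
Proof.
rewrite /average -mulrDr.
transitivity (k.+1%:R^-1 * \sum_(m < k.+1) iter m.+1 markov_step h i).
  rewrite /markov_step; under eq_bigr do rewrite mulrCA.
  rewrite -big_distrr /=; congr (_ * _); rewrite exchange_big /=.
  by apply: eq_bigr => j _; rewrite big_distrr.
congr (_ * _); rewrite [in LHS]big_ord_recr [in RHS]big_ord_recl /=.
rewrite (eq_bigr (fun m : 'I_k => iter m.+1 markov_step h i)) //.
rewrite [in RHS](eq_bigr (fun m : 'I_k => iter m.+1 markov_step h i)) //=.
lra.
Qed.

Lemma mean_average k : mean (average h k) = mean h.
Proof.
have it0 m i : 0 <= iter m markov_step h i by case/andP: (iter_step_bound m i).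
have mit m : mean (iter m markov_step h) = mean h.
  by elim: m => // m IH; rewrite iterS mean_step.
rewrite /average meanZ ?invr_ge0 //; last by move=> i; exact: sumr_ge0.
suff -> n : mean (fun i => \sum_(m < n) iter m markov_step h i) = (n%:R%:E * mean h)%E.
  by rewrite muleA -EFinM mulVf // mul1e.
elim: n => [|n IH].
  by under eq_fun do rewrite big_ord0; rewrite mean_cst // mul0e.
under eq_fun do rewrite big_ord_recr /=.
rewrite meanD //; last by move=> i; exact: sumr_ge0.
by rewrite IH mit -natr1 EFinD ge0_muleDl ?mul1e // lee_fin.
Qed.

(* Expanding the square, the invariance of [nu] turns the Dirichlet form of
   [average h k] into twice the [nu]-mean of [a * (a - Q a)], which is O(1/k). *)
Lemma average_edge k i j :
  nu i * (q i j * (average h k i - average h k j) ^+ 2) <= 2 * M ^+ 2 * k.+1%:R^-1.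
Proof.
set a := average h k; set c := k.+1%:R^-1.
have c0 : 0 <= c by rewrite invr_ge0.
have a0 l : 0 <= a l by case/andP: (average_bound k l).
have aM l : a l <= M by case/andP: (average_bound k l).
have M0 : 0 <= M by apply: le_trans (aM i).
pose w l := \sum_(m <- nb l) q l m * (a l - a m) ^+ 2.
pose a2 l := a l ^+ 2.
have a20 l : 0 <= a2 l by exact: sqr_ge0.
have w0 l : 0 <= w l by apply: sumr_ge0 => m _; rewrite mulr_ge0 // sqr_ge0.
have wE l : w l = a2 l - 2 * a l * markov_step a l + markov_step a2 l.
  rewrite /w (eq_bigr (fun m => q l m * a2 l - 2 * a l * (q l m * a m) +
    q l m * a2 m)); last by move=> m _; rewrite /a2; ring.
  rewrite big_split sumrB /= -big_distrl /= q1 mul1r.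
  by rewrite -big_distrr.
(* Copies of [a2] stand on both sides so that every term is nonnegative and [meanD] applies; the
   finite quantity [mean a2 + mean a2] is cancelled afterwards. *)
have pw l : w l + (a2 l + a2 l) <= a2 l + markov_step a2 l + 2 * M ^+ 2 * c.
  have /andP[t0 tM] := iter_step_bound k.+1 l.
  rewrite wE step_average -/a -/c.
  suff : a l * (c * (h l - iter k.+1 markov_step h l)) <= M ^+ 2 * c.
    by rewrite /a2; lra.
  apply: (@le_trans _ _ (a l * (c * M))).
    apply: ler_wpM2l => //; apply: ler_wpM2l => //.
    by case/andP: (hM l) => _; lra.
  rewrite (mulrC c) mulrA expr2; apply: ler_wpM2r => //.
  by apply: ler_wpM2r.
have Mc : 0 <= 2 * M ^+ 2 * c by rewrite !mulr_ge0 // exprn_ge0.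
have s20 := step_ge0 a20.
have fa2 : mean a2 \is a fin_num.
  apply: (@mean_fin _ (M ^+ 2)); first exact: exprn_ge0.
  move=> l; rewrite a20 /=.
  by rewrite lerXn2r // nnegrE.
have := le_mean pw.
rewrite !meanD ?mean_cst ?mean_step //; last 2 first.
  by move=> l; rewrite addr_ge0.
  by move=> l; rewrite addr_ge0.
rewrite [leLHS]addeC leeD2lE; last by rewrite fin_numD fa2.
move=> mw; rewrite -lee_fin; apply: le_trans mw.
apply: le_trans (le_mean_at i w0); rewrite lee_fin ler_wpM2l //.
have [jn|jn] := boolP (j \in nb i); last first.
  by rewrite q_nb // mul0r w0.
rewrite /w (big_rem j) //= lerDl sumr_ge0 // => m _.
by rewrite mulr_ge0 // sqr_ge0.
Qed.

Lemma average_edge_cvg i j : 0 < q i j ->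
  (fun k => average h k i - average h k j) @ \oo --> 0.
Proof.
move=> qij; have C0 : 0 < nu i * q i j by rewrite mulr_gt0 ?nu_gt0.
set x := fun k => _.
pose C := 2 * M ^+ 2 / (nu i * q i j).
have xb k : x k ^+ 2 <= C * harmonic k.
  rewrite /C /harmonic mulrAC ler_pdivlMr // mulrC -mulrA.
  exact: average_edge.
have hb : (fun k => Num.sqrt (C * harmonic k)) @ \oo --> 0.
  rewrite -[X in _ --> X](@sqrtr0 R).
  have H : (fun k => C * harmonic k) @ \oo --> (0 : R).
    rewrite -[X in _ --> X](mulr0 C).
    by apply: cvgM; [exact: cvg_cst|exact: cvg_harmonic].
  by apply: (cvg_comp _ _ H); exact: sqrt_continuous.
apply: (@squeeze_cvgr _ _ _ _ (fun k => - Num.sqrt (C * harmonic k)) _ _ _ _ _ hb).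
  apply: nearW => k; rewrite -ler_norml -sqrtr_sqr ler_wsqrtr //.
by rewrite -[X in _ --> X]oppr0; exact: cvgN.
Qed.

Lemma average_diff_cvg i j :
  (fun k => average h k i - average h k j) @ \oo --> 0.
Proof.
have [s sp <-] := irr i j.
elim: s i sp => /= [i _|k s IH i /andP[qik /IH]].
  by under eq_fun do rewrite subrr; exact: cvg_cst.
move=> H; rewrite -[X in _ --> X](addr0 (0 : R)).
rewrite (_ : (fun n => _) = (fun n => (average h n i - average h n k) +
  (average h n k - average h n (last k s)))); last first.
  by apply/funext => n; rewrite addrA subrK.
by apply: cvgD => //; exact: average_edge_cvg.
Qed.

Lemma near_seq (I : eqType) (s : seq I) (P : I -> nat -> Prop) :
  (forall i, \forall k \near \oo, P i k) ->
  \forall k \near \oo, forall i, i \in s -> P i k.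
Proof.
move=> H; elim: s => [|i s IH]; first by apply: nearW => k i; rewrite in_nil.
near=> k => j; rewrite in_cons => /predU1P[->|]; first by near: k; exact: H.
by move: j; near: k; exact: IH.
Unshelve. all: by end_near.
Qed.

(** By [average_diff_cvg] the averages become equal across states, while their [nu]-mean always
    remains [mean h]. The bound [M] takes care of the states outside a finite set carrying almost
    all the mass. *)
Lemma average_cvg i : (fun k => average h k i) @ \oo --> fine (mean h).
Proof.
have M0 : 0 <= M by case/andP: (hM i); apply: le_trans.
have mf : mean h \is a fin_num by apply: mean_fin M0 hM.
have h0 l : 0 <= h l by case/andP: (hM l).
have mass e : 0 < e -> exists2 s : seq G, uniq s &
    (mean (fun j => (j \notin s)%:R) <= e%:E)%E.
  move=> e0; have : (1 - e%:E < \esum_(i in [set: G]) (nu i)%:E)%E.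
    by rewrite nu1 lteBlDr // -[ltLHS]adde0 lteD2lE // lte_fin.
  rewrite /esum => /ereal_sup_gt[_ [X [finX _] <-]] eX.
  exists (fset_set X); first exact: fset_uniq.
  have := @meanD (fun j => (j \in (fset_set X : seq G))%:R)
    (fun j => (j \notin (fset_set X : seq G))%:R)
    (fun=> ler0n _ _) (fun=> ler0n _ _).
  under eq_fun do rewrite -natrD addnC addn_negb.
  rewrite mean_cst // => H1.
  have inX : mean (fun j => (j \in (fset_set X : seq G))%:R) =
      (\sum_(j \in X) (nu j)%:E)%E.
    rewrite /mean (@esum_seq _ _ (fset_set X)) //.
    - rewrite fsbig_finite //= !big_seq; apply: eq_bigr => j ->.
      by rewrite mulr1.
    - by move=> j; rewrite lee_fin mulr_ge0.
    - by move=> j /negPf ->; rewrite mulr0.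
  move: eX H1; rewrite -inX.
  set y := mean (fun j => (j \notin _)%:R); set z := mean _.
  have := @mean_fin (fun j => (j \notin (fset_set X : seq G))%:R) 1 ler01.
  have := @mean_fin (fun j => (j \in (fset_set X : seq G))%:R) 1 ler01.
  rewrite -/y -/z => Hz Hy.
  have {}Hz : z \is a fin_num by apply: Hz => j; rewrite ler0n lern1 leq_b1.
  have {}Hy : y \is a fin_num by apply: Hy => j; rewrite ler0n lern1 leq_b1.
  rewrite -(fineK Hz) -(fineK Hy) -EFinB lte_fin lee_fin -EFinD => H2 [H3].
  lra.
apply/cvgrPdist_le => e e0.
(* An error [e1] on the finite set and at most [M * e1] outside it add up to [e]. *)
pose e1 := e / (1 + M); have M1 : 0 < 1 + M by rewrite ltr_pwDl.
have e10 : 0 < e1 by rewrite divr_gt0.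
have [s us ms] := mass _ e10.
have := @near_seq G s (fun j k => `|average h k i - average h k j| <= e1) _.
move=> /(_ _)/filterS; apply; last first.
  move=> j; have /cvgrPdist_le/(_ _ e10) := average_diff_cvg i j.
  by apply: filterS => k; rewrite sub0r normrN.
move=> k ks.
have a0 l : 0 <= average h k l by case/andP: (average_bound k l).
have aM l : average h k l <= M by case/andP: (average_bound k l).
have ce0 : 0 <= average h k i + e1 by rewrite addr_ge0 // ltW.
have Mo l : 0 <= M * (l \notin s)%:R by rewrite mulr_ge0.
have mM : (mean (fun j => (M * (j \notin s)%:R)%R) <= (M * e1)%:E)%E.
  by rewrite meanZ // EFinM lee_wpmul2l.
have up : (mean h <= (average h k i + e1 + M * e1)%:E)%E.
  rewrite -(mean_average k) EFinD.
  apply: (@le_trans _ _ (mean (fun j => average h k i + e1 + M * (j \notin s)%:R))).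
    apply: le_mean => j; have [js|js] := boolP (j \in s).
      by have := ks j js; rewrite mulr0 addr0 ler_distlC; lra.
    by rewrite mulr1 ler_wpDl.
  rewrite (@meanD (fun=> average h k i + e1)) // mean_cst //.
  by rewrite leeD2l.
have lo : ((average h k i)%:E <= mean h + (e1 + M * e1)%:E)%E.
  rewrite -(mean_average k) -[leLHS](mean_cst (a0 i)).
  apply: (@le_trans _ _
    (mean (fun j => average h k j + (e1 + M * (j \notin s)%:R)))).
    apply: le_mean => j; have [js|js] := boolP (j \in s).
      by have := ks j js; rewrite mulr0 addr0 ler_distlC; lra.
    by rewrite mulr1 ler_wpDl // ler_wpDl // ltW.
  have e10' : 0 <= e1 by exact: ltW.
  rewrite meanD //; last by move=> j; rewrite addr_ge0.
  rewrite leeD2l // EFinD (@meanD (fun=> e1)) // mean_cst //.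
  by rewrite leeD2l.
have ee : e = e1 + M * e1 by rewrite /e1; field; rewrite gt_eqF.
move: up lo; rewrite -(fineK mf) -EFinD !lee_fin => up lo.
by rewrite ee ler_distl; apply/andP; split; lra.
Qed.

End bounded.
End ergodic.

(** * Real series *)

Section real_series.
Variable R : realType.

Lemma geometric_bound_cvg (u : R^nat) (C r : R) : 0 <= r < 1 ->
  (forall n, 0 <= u n <= C * r ^+ n) -> cvgn (series u).
Proof.
move=> /andP[r0 r1] u0; apply: (@series_le_cvg _ u (geometric C r)).
- by move=> n; case/andP: (u0 n).
- by move=> n; case/andP: (u0 n); apply: le_trans.
- by move=> n; case/andP: (u0 n).
- by apply: is_cvg_geometric_series; rewrite ger0_norm.
Qed.

Lemma nneg_series_ge (u : R^nat) n : (forall n, 0 <= u n) ->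
  cvgn (series u) -> u n <= limn (series u).
Proof.
move=> u0 cu; apply: (@le_trans _ _ (series u n.+1)).
  by rewrite /series /= big_nat_recr //= lerDr sumr_ge0.
apply: nondecreasing_cvgn_le => //.
by apply/nondecreasing_seqP => m; rewrite /series /= big_nat_recr //= lerDl.
Qed.

Lemma cvg_sum_seq (I : eqType) (s : seq I) (f : I -> R^nat) (l : I -> R) :
  (forall i, i \in s -> f i @ \oo --> l i) ->
  (fun n => \sum_(i <- s) f i n) @ \oo --> \sum_(i <- s) l i.
Proof.
elim: s => [|i s IH] H.
  by rewrite big_nil; under eq_fun do rewrite big_nil; exact: cvg_cst.
rewrite big_cons; under eq_fun do rewrite big_cons.
apply: cvgD; first by apply: H; exact: mem_head.
by apply: IH => j js; apply: H; rewrite in_cons js orbT.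
Qed.

Lemma half_cvgy : (fun n => n./2) @ \oo --> \oo.
Proof.
apply/cvgnyPge => M; exists M.*2 => // n /= Mn.
by rewrite -(doubleK M) half_leq.
Qed.

(* Squeezed between [A_(N/2) S_(N/2)] and [A_N * lim S]. *)
Lemma cauchy_product_cvg (a g : R^nat) : (forall n, 0 <= a n) ->
  (forall n, 0 <= g n) -> cvgn (series a) -> cvgn (series g) ->
  (fun N => \sum_(n < N) a n * series g (N - n.+1)%N) @ \oo -->
  limn (series a) * limn (series g).
Proof.
move=> a0 g0 ca cg.
have ndS : {homo series g : n m / (n <= m)%N >-> n <= m}.
  by apply/nondecreasing_seqP => m; rewrite /series /= big_nat_recr //= lerDl.
have Sl n : series g n <= limn (series g) by apply: nondecreasing_cvgn_le.
have S0 n : 0 <= series g n by apply: sumr_ge0.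
apply: (@squeeze_cvgr _ _ _ _ (fun N => series a N./2 * series g N./2)
  (fun N => series a N * limn (series g))).
- apply: nearW => N; apply/andP; split; last first.
    rewrite [series a N]/series /= big_mkord big_distrl /=; apply: ler_sum => n _.
    by rewrite ler_wpM2l.
  have N2 : (N./2 <= N)%N by lia.
  rewrite [series a _]/series /= -(big_mkord predT (fun n => a n * series g (N - n.+1)%N)).
  rewrite (big_cat_nat (leq0n _) N2) /= -[leLHS]addr0 lerD //.
    rewrite big_distrl /= big_nat [leRHS]big_nat ler_sum // => n /andP[_ nN].
    by apply: ler_wpM2l => //; apply: ndS; lia.
  by apply: sumr_ge0 => n _; rewrite mulr_ge0.
- have H1 := cvg_comp _ _ half_cvgy ca; have H2 := cvg_comp _ _ half_cvgy cg.
  exact: cvgM H1 H2.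
- by apply: cvgM => //; exact: cvg_cst.
Qed.

(** Turns a last-exit decomposition at a fixed time into one for partial Green sums. The shift
    [n.+1] is the unit of time spent on the edge that enters the subtree. *)
Lemma cauchy_product_series (a g b : R^nat) :
  (forall N, b N = \sum_(n < N) a n * g (N - n.+1)%N) ->
  forall M, series b M = \sum_(n < M) a n * series g (M - n.+1)%N.
Proof.
move=> bE; elim=> [|M IH]; first by rewrite big_ord0 /series /= big_geq.
have -> : series b M.+1 = series b M + b M by rewrite /series /= big_nat_recr.
rewrite IH bE -big_split /=.
rewrite big_ord_recr /= subnn [series g 0]/series /= big_geq // mulr0 addr0.
apply: eq_bigr => n _; rewrite -mulrDr; congr (_ * _).
have -> : (M.+1 - n.+1 = (M - n.+1).+1)%N by have := ltn_ord n; lia.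
by rewrite [RHS]/series /= big_nat_recr.
Qed.

(** A radius of convergence above 1 gives convergence at some [r > 1]; the terms [a n * r ^+ n] are
    then bounded, and the rate is [r^-1]. *)
Lemma spectral_bound (a : R^nat) : (forall n, 0 <= a n) ->
  ((convergence_radius a)^-1 < 1)%E ->
  exists C r : R, [/\ 0 <= C, 0 < r < 1 & forall n, a n <= C * r ^+ n].
Proof.
move=> a0; set S := [set r%:E | r in [set r : R | 0 <= r /\ cvgn (pseries a r)]].
rewrite /convergence_radius -/S.
(* Convergence at 0 makes the supremum nonnegative. The value 0 is excluded by the hypothesis, the
   inverse of 0 being [+oo]. *)
have S0 : S 0%E.
  exists 0 => //; split=> //.
  apply: (@geometric_bound_cvg _ (a 0%N) 0); first by rewrite lexx ltr01.
  case=> [|n] /=; first by rewrite !expr0 !mulr1 a0 lexx.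
  by rewrite !exprS !mul0r !mulr0 lexx.
have sup0 : (0 <= ereal_sup S)%E by apply: ereal_sup_ubound.
move=> inv1; have : (1 < ereal_sup S)%E.
  case: (ereal_sup S) sup0 inv1 => [s|//|//]; last by rewrite ltry.
  rewrite lee_fin lte_fin => s0; have [->|sn0] := eqVneq s 0.
    by rewrite inve0.
  rewrite inver (negPf sn0) lte_fin; have {}s0 : 0 < s by rewrite lt_neqAle eq_sym sn0.
  by rewrite invf_lt1.
move=> /ereal_sup_gt[_ [r [r0 cr] <-]]; rewrite lte_fin => r1.
have rp : 0 < r by exact: lt_trans r1.
have := cvg_series_cvg_0 cr => ar0.
have /cvg_seq_bounded [M [_ HM]] : cvgn (fun n => a n * r ^+ n) by apply: cvgP ar0.
have HM1 := HM (`|M| + 1) (ltr_pwDr ltr01 (ler_norm M)).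
exists (`|M| + 1), r^-1; split; first by rewrite addr_ge0.
  by rewrite invr_gt0 rp invf_lt1.
move=> n; rewrite exprVn ler_pdivlMr ?exprn_gt0 //.
by apply: le_trans (ler_norm _) _; exact: HM1.
Qed.

End real_series.

(** * The directed cover *)

Section tree.
Variables (G : countType) (E : rel G) (i0 : G) (nb : G -> seq G).
Hypothesis nbE : forall i j, (j \in nb i) = E i j.
Hypothesis nb_uniq : forall i, uniq (nb i).
Local Notation T := (dcover E i0).
Local Notation o := (cover_root E i0).
Implicit Types x y z : T.

(* If there is no edge from the label of x to j, then [ext x j] is x itself. *)
Definition ext x (j : G) : T :=
  insubd (x : {s : seq G | path E i0 s}) (rcons (val x) j).

Definition anc (L : nat) x : T :=
  exist (fun s => path E i0 s) _ (take_path L (valP x)).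

Lemma val_anc L x : val (anc L x) = take L (val x). Proof. by []. Qed.

Lemma parent_anc x : parent x = anc (level x).-1 x.
Proof. exact: val_inj. Qed.

Lemma val_ext x j : E (tau x) j -> val (ext x j) = rcons (val x) j.
Proof.
move=> xj; rewrite /ext val_insubd rcons_path (valP x) /=.
by rewrite /tau in xj; rewrite xj.
Qed.

Lemma tau_ext x j : E (tau x) j -> tau (ext x j) = j.
Proof. by move=> xj; rewrite /tau val_ext // last_rcons. Qed.

Lemma level_ext x j : E (tau x) j -> level (ext x j) = (level x).+1.
Proof. by move=> xj; rewrite /level val_ext // size_rcons. Qed.

Lemma ext_root x j : E (tau x) j -> ext x j != o.
Proof. by move=> xj; rewrite cover_root_level level_ext. Qed.

Lemma take_rcons_le (s : seq G) j L : (L <= size s)%N ->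
  take L (rcons s j) = take L s.
Proof. by move=> Ls; rewrite -cats1 takel_cat. Qed.

Lemma anc_ext x j L : E (tau x) j -> (L <= level x)%N ->
  anc L (ext x j) = anc L x.
Proof.
by move=> xj Lx; apply: val_inj; rewrite !val_anc val_ext // take_rcons_le.
Qed.

Lemma anc_id x L : (level x <= L)%N -> anc L x = x.
Proof. by move=> xL; apply: val_inj; rewrite val_anc take_oversize. Qed.

Lemma level_anc L x : level (anc L x) = minn L (level x).
Proof. by rewrite /level val_anc size_take_min. Qed.

Lemma anc_anc L M x : (L <= M)%N -> anc L (anc M x) = anc L x.
Proof. by move=> LM; apply: val_inj; rewrite !val_anc take_takel. Qed.

Lemma parent_ext x j : E (tau x) j -> parent (ext x j) = x.
Proof.
move=> xj; rewrite parent_anc level_ext //= anc_ext //.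
exact: anc_id.
Qed.

Lemma val_parent x : x != o -> val x = rcons (val (parent x)) (tau x).
Proof.
rewrite cover_root_level /level => x0.
suff key (s : seq G) : size s != 0%N -> s = rcons (take (size s).-1 s) (last i0 s).
  exact: key.
case/lastP: s => // s j _.
by rewrite size_rcons /= last_rcons take_rcons_le // take_size.
Qed.

Lemma edge_parent x : x != o -> E (tau (parent x)) (tau x).
Proof.
move=> x0; have := valP x; rewrite /= (val_parent x0) rcons_path /=.
by case/andP.
Qed.

Lemma parentK x : x != o -> ext (parent x) (tau x) = x.
Proof.
move=> x0; apply: val_inj; rewrite val_ext ?edge_parent //.
by rewrite -val_parent.
Qed.

Lemma parent_root : parent o = o.
Proof. exact: val_inj. Qed.

Lemma level_root : level o = 0%N. Proof. by []. Qed.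

Lemma ext_inj x j k : E (tau x) j -> E (tau x) k -> ext x j = ext x k -> j = k.
Proof. by move=> xj xk /(congr1 (@tau _ _ _)); rewrite !tau_ext. Qed.

Lemma level_parentS x : x != o -> level x = (level (parent x)).+1.
Proof. by rewrite cover_root_level level_parent -lt0n => /prednK. Qed.

Lemma is_child_ext x j : E (tau x) j -> is_child x (ext x j).
Proof. by move=> xj; rewrite /is_child ext_root // parent_ext // eqxx. Qed.

Definition children x : seq T := [seq ext x j | j <- nb (tau x)].

Lemma children_uniq x : uniq (children x).
Proof.
rewrite map_inj_in_uniq // => j k; rewrite !nbE => xj xk.
exact: ext_inj.
Qed.

Lemma mem_children x y : (y \in children x) = is_child x y.
Proof.
apply/mapP/idP => [[j]|].
  by rewrite nbE => xj ->; exact: is_child_ext.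
case/andP => y0 /eqP yx; exists (tau y); rewrite -?yx ?parentK //.
by rewrite nbE edge_parent.
Qed.

Lemma is_child_neq x y : is_child x y -> x != y.
Proof.
move=> /level_child xy; apply/eqP => e; move: xy; rewrite e => /eqP.
by rewrite -[X in X == _]addn0 -addn1 eqn_add2l.
Qed.

Lemma parent_notin_children x : parent x \notin children x.
Proof.
rewrite mem_children; apply/negP => /level_child.
by rewrite level_parent => /eqP; rewrite ltn_eqF // ltnS leq_pred.
Qed.

(** Spheres and balls are finite lists because the degrees are finite. The law at time [n] is
    carried by [tball n], so all the entropies below are finite sums. *)
Fixpoint lev (L : nat) : seq T :=
  if L is L'.+1 then flatten [seq children x | x <- lev L'] else [:: o].

Fixpoint tball (n : nat) : seq T :=
  if n is n'.+1 then tball n' ++ lev n else lev 0.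

Lemma mem_lev L x : (x \in lev L) = (level x == L).
Proof.
elim: L x => [x|L IH x] /=; first by rewrite inE cover_root_level.
apply/flattenP/eqP => [[_ /mapP[y yL ->]]|xL].
  by rewrite mem_children => /level_child ->; move: yL; rewrite IH => /eqP ->.
have x0 : x != o by rewrite cover_root_level xL.
exists (children (parent x)); last by rewrite mem_children /is_child x0 eqxx.
by apply: map_f; rewrite IH -eqSS -level_parentS // xL.
Qed.

Lemma lev_uniq L : uniq (lev L).
Proof.
elim: L => // L IH /=.
elim: (lev L) IH => //= x s IHs /andP[xs us].
rewrite cat_uniq children_uniq IHs // andbT; apply/hasPn => y /=.
move=> /flattenP[_ /mapP[z zs ->]]; rewrite !mem_children.
case/andP => _ /eqP pz; apply/negP; case/andP => _ /eqP px.
by move: xs; rewrite -px pz zs.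
Qed.

Lemma mem_tball n x : (x \in tball n) = (level x <= n)%N.
Proof.
elim: n => [|n IH]; first by rewrite mem_lev leqn0.
by rewrite mem_cat IH mem_lev [RHS]leq_eqVlt orbC ltnS.
Qed.

Lemma tball_uniq n : uniq (tball n).
Proof.
elim: n => // n IH; rewrite [tball _]/= cat_uniq IH [uniq _](lev_uniq n.+1) andbT.
apply/hasPn => x; rewrite [x \in _](mem_lev n.+1) => /eqP xn /=.
by rewrite mem_tball xn ltnn.
Qed.

Lemma big_lev (V : nmodType) (f : T -> V) L :
  \sum_(x <- lev L.+1) f x = \sum_(x <- lev L) \sum_(j <- nb (tau x)) f (ext x j).
Proof.
by rewrite big_flatten big_map; apply: eq_bigr => x _; rewrite big_map.
Qed.

Lemma big_tball (V : nmodType) (f : T -> V) n :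
  \sum_(x <- tball n.+1) f x = \sum_(x <- tball n) f x + \sum_(x <- lev n.+1) f x.
Proof. by rewrite [tball _]/= big_cat. Qed.

(** * Kraft sums for descendants in the tree *)

Section code.
Variables (R : realType) (D : nat).
Hypothesis nbD : forall i, (size (nb i) <= D)%N.

(** The factor [D.+1] outweighs the branching, and the factor 2 makes the contributions of
    successive levels summable. *)
Definition code_base : R := (2 * D.+1%:R)^-1.

(** A code for a vertex whose ancestor at level [L] is known: [- ln] of this weight is a length
    proportional to the gap of levels plus 1. With [L = 0] it is the fallback code for an arbitrary
    vertex. *)
Definition theta (L : nat) x : R := code_base ^+ (level x - L).+1.

Lemma code_base_gt0 : 0 < code_base.
Proof. by rewrite invr_gt0 mulr_gt0. Qed.

Lemma theta_gt0 L x : 0 < theta L x.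
Proof. by rewrite exprn_gt0 // code_base_gt0. Qed.

Lemma code_base_lt1 : code_base < 1.
Proof.
rewrite invf_lt1 ?mulr_gt0 // (@lt_le_trans _ _ 2) ?ltr1n // ler_peMr //.
by rewrite ler1n.
Qed.

Lemma ln_theta L x : - ln (theta L x) = (level x - L).+1%:R * - ln code_base.
Proof. by rewrite /theta lnXn ?code_base_gt0 // -mulNrn mulr_natl. Qed.

Lemma card_lev_anc L b n :
  \sum_(x <- lev (L + n) | anc L x == b) (1 : R) <= D.+1%:R ^+ n.
Proof.
elim: n => [|n IH].
  rewrite addn0 expr0 big_seq_cond.
  rewrite (eq_bigl (fun x => (x \in lev L) && (x == b))); last first.
    move=> x; case: (boolP (x \in lev L)) => //=.
    by rewrite mem_lev => /eqP xL; rewrite anc_id // xL.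
  rewrite -big_seq_cond -big_filter.
  have [bL|bL] := boolP (b \in lev L).
    by rewrite (@filter_pred1_uniq _ (lev L)) ?lev_uniq // big_seq1.
  rewrite big_filter big_seq_cond big_pred0 // => x.
  by apply/negP => /andP[xL /eqP xb]; rewrite -xb xL in bL.
rewrite addnS big_mkcond big_lev exprSr.
apply: (@le_trans _ _ (\sum_(x <- lev (L + n) | anc L x == b) D.+1%:R)).
  rewrite [leRHS]big_mkcond big_seq [leRHS]big_seq; apply: ler_sum => x.
  rewrite mem_lev => /eqP xn.
  rewrite (eq_big_seq (fun=> if anc L x == b then 1 : R else 0)); last first.
    by move=> j; rewrite nbE => xj; rewrite anc_ext // xn leq_addr.
  case: ifP => _; last by rewrite big1.
  by rewrite big_const_seq count_predT iter_addr_0 ler_nat (leq_trans (nbD _)).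
rewrite -[X in \sum_(_ <- _ | _) X]mul1r -big_distrl /=.
by apply: ler_wpM2r.
Qed.

(** At most [D.+1 ^+ k] descendants of [b] lie [k] levels below it, each of weight
    [code_base ^+ k.+1], so that level contributes at most [2^-1 ^+ k.+1]. Keeping the geometric
    remainder lets the induction on [n] close. *)
Lemma sum_theta L b n :
  \sum_(x <- tball (L + n) | (L <= level x)%N && (anc L x == b)) theta L x
    <= 1 - 2^-1 ^+ n.+1.
Proof.
have levn k : \sum_(x <- lev (L + k) | (L <= level x)%N && (anc L x == b))
    theta L x <= 2^-1 ^+ k.+1.
  rewrite big_seq_cond.
  rewrite (eq_bigr (fun=> code_base ^+ k.+1)); last first.
    by move=> x; rewrite mem_lev /theta => /andP[/eqP -> _]; rewrite addKn.
  apply: (@le_trans _ _ (\sum_(x <- lev (L + k) | anc L x == b)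
      code_base ^+ k.+1)).
    rewrite -big_seq_cond big_mkcond [leRHS]big_mkcond ler_sum // => x _.
    by case: (L <= _)%N => //=; case: ifP => // _; rewrite exprn_ge0 // ltW ?code_base_gt0.
  rewrite -[X in \sum_(_ <- _ | _) X]mul1r -big_distrl /=.
  apply: (@le_trans _ _ (D.+1%:R ^+ k * code_base ^+ k.+1)).
    by apply: ler_wpM2r (card_lev_anc L b k); rewrite exprn_ge0 // ltW ?code_base_gt0.
  rewrite /code_base invfM !exprMn mulrCA; apply: ler_piMr.
    by rewrite exprn_ge0.
  rewrite exprVn exprSr invfM mulrA divff ?expf_neq0 //.
  by rewrite mul1r invf_le1 // ler1n.
elim: n => [|n IH].
  rewrite addn0; case: L b levn => [|L] b levn.
    apply: le_trans (levn 0%N) _; rewrite expr1; lra.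
  rewrite big_mkcond big_tball -big_mkcond -[X in _ + X]big_mkcond.
  rewrite big_seq_cond big_pred0 ?add0r; last first.
    by move=> x; rewrite mem_tball; case: leqP.
  apply: le_trans (_ : 2^-1 ^+ 1 <= _); last by rewrite expr1; lra.
  by have := levn 0%N; rewrite addn0.
rewrite addnS big_mkcond big_tball -big_mkcond -[X in _ + X]big_mkcond.
apply: (le_trans (lerD IH _)); first by rewrite -addnS; exact: levn.
rewrite [in leRHS]exprS [in leLHS](exprS _ n.+1); lra.
Qed.

End code.

End tree.

(** * Path weights *)

Section kernel.
Variables (R : realType) (G : countType) (E : rel G) (i0 : G) (nb : G -> seq G).
Variables (pG : G -> G -> R) (pback : G -> R).
Hypothesis nbE : forall i j, (j \in nb i) = E i j.
Hypothesis nb_uniq : forall i, uniq (nb i).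
Hypothesis pfwd0 : forall i j, 0 <= pfwd pG pback i j.
Hypothesis pback0 : forall i, 0 <= pback i.
Local Notation T := (dcover E i0).
Local Notation o := (cover_root E i0).
Local Notation K := (@walk_kernel R G E i0 pG pback).
Implicit Types (x y z : T) (A : pred T).

Lemma K_ge0 x y : 0 <= K x y.
Proof. by rewrite /walk_kernel; do 3?case: ifP. Qed.

Lemma K_parent y : y != o -> K (parent y) y = pfwd pG pback (tau (parent y)) (tau y).
Proof. by move=> y0; rewrite /walk_kernel /is_child y0 eqxx. Qed.

Lemma is_child_asym x y : is_child x y -> is_child y x = false.
Proof. by move=> /level_child xy; apply/negP => /level_child; lia. Qed.

Lemma K_child x y : is_child x y -> K y x = pback (tau y).
Proof. by move=> xy; rewrite /walk_kernel xy is_child_asym. Qed.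

Lemma K_ext y j : E (tau y) j -> K (ext y j) y = pback j.
Proof. by move=> yj; rewrite K_child ?is_child_ext // tau_ext. Qed.

Lemma K_eq0 z y : z \notin parent y :: children nb y -> K z y = 0.
Proof.
rewrite inE negb_or (mem_children nbE) => /andP[zp /negPf zc].
rewrite /walk_kernel zc /is_child [parent y == z]eq_sym (negPf zp) andbF.
case: ifP => // /andP[/eqP zo /eqP yo]; move: zp; rewrite zo yo parent_root.
by rewrite eqxx.
Qed.

Lemma K_gt0_adj x y : 0 < K x y ->
  [\/ is_child x y, is_child y x | x = o /\ y = o].
Proof.
rewrite /walk_kernel; case: ifP => [_ _|_]; first by constructor 1.
case: ifP => [_ _|_]; first by constructor 2.
by case: ifP => [/andP[/eqP -> /eqP ->] _|]; [constructor 3|rewrite ltxx].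
Qed.

(* The weight of the paths of length n from x to y all of whose vertices but
   the last one are in A. As [parent o = o], the first summand is the loop when
   y = o. *)
Fixpoint path_weight A x (n : nat) y : R :=
  if n is n'.+1 then
    (A (parent y))%:R * path_weight A x n' (parent y) * K (parent y) y +
    \sum_(j <- nb (tau y)) (A (ext y j))%:R * path_weight A x n' (ext y j) * pback j
  else (x == y)%:R.

Lemma path_weight_ge0 A x n y : 0 <= path_weight A x n y.
Proof.
elim: n y => [|n IH] y /=; first exact: ler0n.
rewrite addr_ge0 ?mulr_ge0 ?K_ge0 //; apply: sumr_ge0 => j _.
by rewrite !mulr_ge0.
Qed.

Lemma path_weight_nbrs A x n y : path_weight A x n.+1 y =
  \sum_(z <- parent y :: children nb y) (A z)%:R * path_weight A x n z * K z y.
Proof.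
rewrite big_cons big_map /=; congr (_ + _).
by apply: eq_big_seq => j; rewrite nbE => yj; rewrite K_ext.
Qed.

Lemma path_weight_level A x n y : (level x + n < level y)%N -> path_weight A x n y = 0.
Proof.
elim: n y => [|n IH] y /=.
  by rewrite addn0; case: eqP => // ->; rewrite ltnn.
move=> xy; rewrite IH; last by rewrite level_parent; lia.
rewrite mulr0 mul0r add0r big_seq big1 // => j.
rewrite nbE => yj; rewrite IH ?mulr0 ?mul0r //.
by rewrite level_ext //; lia.
Qed.

Definition walk_law n y : R := path_weight predT o n y.

Lemma walk_lawE n y : walk_law n y = path_weight predT o n y. Proof. by []. Qed.

Lemma walk_law_level n y : (n < level y)%N -> walk_law n y = 0.
Proof. by move=> ny; rewrite /walk_law path_weight_level. Qed.

Lemma walk_law_parent n y : y != o -> walk_law n y * pback (tau y) <= walk_law n.+1 (parent y).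
Proof.
move=> y0; rewrite /walk_law /= ler_wpDl //.
  by rewrite !mulr_ge0 ?path_weight_ge0 ?K_ge0.
rewrite (big_rem (tau y)) /=; last by rewrite nbE edge_parent.
rewrite parentK // mul1r lerDl; apply: sumr_ge0 => j _.
by rewrite !mulr_ge0 ?path_weight_ge0.
Qed.

(** From [y] the walk may go straight back to the root, in [level y] steps of probability at least
    [e] each. *)
Lemma walk_law_root (e : R) n y : 0 <= e -> (forall i, e <= pback i) ->
  walk_law n y * e ^+ level y <= walk_law (n + level y) o.
Proof.
move=> e0 eb; move: n; have [m] := ubnP (level y); elim: m y => // m IH y ym n.
have [->|y0] := eqVneq y o; first by rewrite level_root expr0 mulr1 addn0.
rewrite (level_parentS y0) addnS -addSn exprS mulrA.
apply: le_trans (IH (parent y) _ n.+1); last first.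
  by move: ym; rewrite (level_parentS y0).
apply: ler_wpM2r; first by rewrite exprn_ge0.
by apply: le_trans (walk_law_parent n y0); rewrite ler_wpM2l ?path_weight_ge0.
Qed.

(** * The walk started at a vertex and killed at its ancestor *)

Section subtree.
Variable x : T.
Hypothesis x0 : x != o.
Local Notation A := (predC1 (parent x)).

Lemma anc_parentx : anc (level x) (parent x) != x.
Proof.
apply/eqP => /(congr1 (@level _ _ _)); rewrite level_anc (level_parentS x0).
lia.
Qed.

Lemma subtree_neq y : anc (level x) y = x -> y != parent x.
Proof. by move=> yx; apply/eqP => e; move: anc_parentx; rewrite -e yx eqxx. Qed.

Lemma subtree_ext y j : E (tau y) j -> anc (level x) y = x ->
  anc (level x) (ext y j) = x.
Proof.
move=> yj yx; rewrite anc_ext //.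
by rewrite -{1}yx level_anc geq_minr.
Qed.

Lemma subtree_parent y : anc (level x) y = x -> y != x ->
  anc (level x) (parent y) = x.
Proof.
move=> yx ynx; rewrite parent_anc anc_anc //.
suff : (level x < level y)%N by move=> ?; lia.
by rewrite ltnNge; apply: contra ynx => /anc_id <-; rewrite yx.
Qed.

(** The vertex [parent x] is the only gate out of the subtree of [x], and a path may reach it only
    at its last step because [A] fails there. *)
Lemma path_weight_supp n y : path_weight A x n y != 0 -> y = parent x \/ anc (level x) y = x.
Proof.
elim: n y => [|n IH] y.
  by rewrite /= pnatr_eq0 eqb0 negbK => /eqP <-; right; rewrite anc_id.
move=> h; apply: contrapT => /not_orP[yp yx].
move: h; rewrite path_weight_nbrs big_seq big1 ?eqxx // => z znb.
have [->|] := eqVneq (path_weight A x n z) 0; first by rewrite mulr0 mul0r.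
move=> /IH[->|zx]; first by rewrite /= eqxx !mul0r.
exfalso; move: znb; rewrite inE => /predU1P[zy|].
  have [y0|y0] := eqVneq y o.
    by apply: yx; move: zx; rewrite zy y0 parent_root.
  have := subtree_ext (edge_parent y0); rewrite parentK // -zy => /(_ zx).
  exact: yx.
rewrite (mem_children nbE) => /andP[z0 /eqP zy].
have [e|znx] := eqVneq z x; first by apply: yp; rewrite -zy e.
by apply: yx; rewrite -zy; apply: subtree_parent.
Qed.

Lemma path_weight_exit n : path_weight A x n.+1 (parent x) = path_weight A x n x * pback (tau x).
Proof.
rewrite /=.
(* The grandparent is outside the support, unless it coincides with [parent x] at the root, where
   [A] fails. *)
have -> : (A (parent (parent x)))%:R * path_weight A x n (parent (parent x)) = 0 :> R.
  apply/eqP; rewrite mulf_eq0 pnatr_eq0 eqb0 negbK; apply/orP.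
  have [e|pp] := eqVneq (parent (parent x)) (parent x); [by left|right].
  apply/negPn/negP => /path_weight_supp[/eqP|]; first by rewrite (negPf pp).
  move/(congr1 (@level _ _ _)); rewrite level_anc !level_parent.
  by rewrite (level_parentS x0); lia.
rewrite mul0r add0r (big_rem (tau x)) /=; last by rewrite nbE edge_parent.
rewrite parentK // [X in _ + X]big_seq big1 ?addr0.
  have -> : x != parent x by rewrite subtree_neq // anc_id.
  by rewrite mul1r.
move=> j; rewrite mem_rem_uniq // inE nbE => /andP[jx xj].
have -> : path_weight A x n (ext (parent x) j) = 0; last by rewrite mulr0 mul0r.
have xx : anc (level x) x = x by rewrite anc_id.
apply/eqP/negPn/negP => /path_weight_supp[/(congr1 (@level _ _ _))|].
  by rewrite level_ext //; lia.
rewrite anc_id; last by rewrite level_ext // (level_parentS x0).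
by move=> /(congr1 (@tau _ _ _)); rewrite tau_ext // => e; rewrite e eqxx in jx.
Qed.

(** Last-exit decomposition: [n] is the last time spent at [parent x], the next step enters [x], and
    the remaining [N - n.+1] steps avoid [parent x]. The induction on [N] splits off the final step
    of the path. *)
Lemma path_weight_conv N y : anc (level x) y = x ->
  walk_law N y = \sum_(n < N) walk_law n (parent x) * K (parent x) x * path_weight A x (N - n.+1) y.
Proof.
elim: N y => [|N IH] y yx.
  rewrite big_ord0 /walk_law /=; case: eqP => // yo; move: x0.
  by rewrite -yx -yo anc_id ?level_root // eqxx.
rewrite big_ord_recr /= subnn.
under eq_bigr => n _.
  have -> : (N.+1 - n.+1 = (N - n.+1).+1)%N by have := ltn_ord n; lia.
  rewrite path_weight_nbrs big_cons mulrDr.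
  over.
rewrite big_split /=.
have -> : \sum_(i < N) walk_law i (parent x) * K (parent x) x *
     (\sum_(z <- children nb y) (z != parent x)%:R * path_weight A x (N - i.+1) z * K z y)
   = \sum_(z <- children nb y) (predT z)%:R * walk_law N z * K z y.
  under eq_bigr do rewrite big_distrr.
  rewrite exchange_big /=; apply: eq_big_seq => z.
  rewrite (mem_children nbE) => zy.
  have zx : anc (level x) z = x.
    case/andP: (zy) => z0 /eqP pz; rewrite -(parentK z0) pz.
    by apply: subtree_ext => //; rewrite -pz edge_parent.
  rewrite IH // mul1r big_distrl /=; apply: eq_bigr => n _.
  by rewrite subtree_neq // mul1r mulrA.
rewrite addrAC {1}/walk_law path_weight_nbrs big_cons; congr (_ + _).
(* At [y = x] the final step from [parent x] is exactly the new summand [n = N], and the other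
   summands through [parent x] vanish because [A] fails there. *)
rewrite -/(walk_law _ _) mul1r; have [->|ynx] := eqVneq y x.
  rewrite /= eqxx mulr1 -[LHS]add0r; congr (_ + _).
  by apply/esym/big1 => n _; rewrite /= !mul0r mulr0.
rewrite mulr0 addr0 IH ?subtree_parent //.
rewrite big_distrl /=; apply: eq_bigr => n _.
by rewrite subtree_neq ?subtree_parent // mul1r mulrA.
Qed.

End subtree.

(** Two subtrees whose roots have the same label are isomorphic: the vertices are matched by their
    common suffix [s]. This justifies evaluating [Fback] and [Gbar] at one representative. *)
Lemma path_weight_label x x' n s y y' : x != o -> x' != o -> tau x = tau x' ->
  val y = val x ++ s -> val y' = val x' ++ s ->
  path_weight (predC1 (parent x)) x n y = path_weight (predC1 (parent x')) x' n y'.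
Proof.
move=> x0 x'0 xx'; elim: n s y y' => [|n IH] s y y' ys ys'.
  rewrite /=; congr (_%:R); congr nat_of_bool.
  rewrite -!val_eqE ys ys' -{1}(cats0 (val x)) -{1}(cats0 (val x')).
  by rewrite !eqseq_cat // !eqxx.
have subt (w w' : T) t : val w' = val w ++ t -> anc (level w) w' = w.
  by move=> e; apply: val_inj; rewrite val_anc e take_size_cat.
have tauy : tau y = tau y'.
  by rewrite /tau ys ys' !last_cat -/(tau x) -/(tau x') xx'.
rewrite /= tauy; congr (_ + _); last first.
  apply: eq_big_seq => j; rewrite nbE => y'j.
  have yj : E (tau y) j by rewrite tauy.
  rewrite (IH (rcons s j) _ (ext y' j)) ?val_ext ?ys ?ys' ?rcons_cat //.
  rewrite (subtree_neq x0 (subtree_ext yj (subt _ _ _ ys))).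
  by rewrite (subtree_neq x'0 (subtree_ext y'j (subt _ _ _ ys'))).
have [s0|sn0] := eqVneq s [::].
  have -> : y = x by apply: val_inj; rewrite ys s0 cats0.
  have -> : y' = x' by apply: val_inj; rewrite ys' s0 cats0.
  by rewrite !eqxx !mul0r.
case/lastP: s sn0 ys ys' => // s j _ ys ys'.
have y0 : y != o by rewrite cover_root_level /level ys size_cat size_rcons addnS.
have y'0 : y' != o by rewrite cover_root_level /level ys' size_cat size_rcons addnS.
have pys : val (parent y) = val x ++ s.
  by rewrite parent_anc val_anc /level ys -rcons_cat size_rcons take_rcons_le ?take_size.
have pys' : val (parent y') = val x' ++ s.
  by rewrite parent_anc val_anc /level ys' -rcons_cat size_rcons take_rcons_le ?take_size.
rewrite (IH s _ (parent y')) // !K_parent // tauy.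
rewrite (subtree_neq x0 (subt _ _ _ pys)) (subtree_neq x'0 (subt _ _ _ pys')).
have -> : tau (parent y) = tau (parent y'); last by [].
by rewrite /tau pys pys' !last_cat -/(tau x) -/(tau x') xx'.
Qed.

End kernel.

(** * The law of the walk *)

Section discrete_variable.
Variables (R : realType) (d : measure_display) (Omega : measurableType d).
Variables (S : countType) (Y : Omega -> S).
Hypothesis mY : forall y, measurable [set w | Y w = y].

Lemma measurable_discrete (Q : S -> Prop) : measurable [set w | Q (Y w)].
Proof.
rewrite (_ : [set w | _] = \bigcup_(y : S) (if `[< Q y >] then [set w | Y w = y] else set0)).
  apply: countable_bigcupT_measurable; first exact: countableP.
  by move=> y; case: ifP.
apply/seteqP; split=> w /=.
  by move=> Qw; exists (Y w) => //; case: asboolP.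
by case=> y _; case: asboolP => //= Qy ->.
Qed.

Lemma measure_fibers (mu : {measure set Omega -> \bar R}) B : measurable B ->
  (mu B = \esum_(y in [set: S]) mu (B `&` [set w | Y w = y]))%E.
Proof.
move=> mB.
pose F n := if pickle_inv n is Some y then B `&` [set w | Y w = y] else set0.
have mF n : measurable (F n).
  by rewrite /F; case: pickle_inv => // y; exact: measurableI.
have BF : B = \bigcup_n F n.
  apply/seteqP; split=> w.
    by move=> Bw; exists (choice.pickle (Y w)) => //; rewrite /F pickleK_inv.
  by case=> n _; rewrite /F; case: pickle_inv => //= y [].
rewrite [in LHS]BF measure_semi_bigcup -?BF //; last first.
  move=> n m _ _ [w []]; rewrite /F.
  have := @pickle_invK S n; have := @pickle_invK S m.
  case: (pickle_inv m) => [z|] /=; last by move=> _ _ _ [].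
  case: (pickle_inv n) => [y|] /=; last by move=> _ _ [].
  by move=> <- <- [_ <-] [_ <-].
rewrite nneseries_esumT //.
rewrite (esumID (range (@choice.pickle S))) // [X in (_ + X)%E]esum1 ?adde0; last first.
  move=> n [_ nr]; rewrite /F.
  have := @pickle_invK S n; case: pickle_inv => [y /= yn|]; last by rewrite measure0.
  by case: nr; exists y.
rewrite setTI (@reindex_esum _ _ _ [set: S] _ (@choice.pickle S)) //.
  by apply: eq_esum => y _; rewrite /F pickleK_inv.
split=> [y _|y z _ _|n [y _ <-]].
- by exists y.
- exact: (pcan_inj choice.pickleK).
- by exists y.
Qed.

Lemma measure_fibers_seq (mu : {measure set Omega -> \bar R}) B (s : seq S) :
  measurable B -> uniq s ->
  (forall y, y \notin s -> mu (B `&` [set w | Y w = y]) = 0%E) ->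
  (mu B = \sum_(y <- s) mu (B `&` [set w | Y w = y]))%E.
Proof. by move=> mB us ys; rewrite (measure_fibers mu mB) (esum_seq us). Qed.

End discrete_variable.

Section chain.
Variables (R : realType) (G : countType) (E : rel G) (i0 : G) (nb : G -> seq G).
Variables (pG : G -> G -> R) (pback : G -> R).
Hypothesis nbE : forall i j, (j \in nb i) = E i j.
Hypothesis nb_uniq : forall i, uniq (nb i).
Hypothesis pfwd0 : forall i j, 0 <= pfwd pG pback i j.
Hypothesis pback0 : forall i, 0 <= pback i.
Local Notation T := (dcover E i0).
Local Notation o := (cover_root E i0).
Local Notation K := (@walk_kernel R G E i0 pG pback).
Local Notation path_weight := (path_weight nb pG pback).
Local Notation walk_law := (walk_law nb pG pback).
Variables (d : measure_display) (Omega : measurableType d).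
Variables (P : T -> probability Omega R) (X : nat -> Omega -> T).
Hypothesis hX : markov_chain K P X.
Implicit Types (x y z : T) (A : pred T).

Lemma mX n y : measurable [set w | X n w = y].
Proof. by case: hX => H _; exact: H. Qed.

(** Interpolates between the cylinders in [markov_chain] ([j = 0]) and the event that [X n] is
    prescribed while the earlier positions are only required to lie in [A] ([j = n]). *)
Definition traj_event A (j n : nat) (s : nat -> T) : set Omega :=
  [set w | (forall m, (m < j)%N -> A (X m w)) /\
           (forall k, (j <= k <= n)%N -> X k w = s k)].

Lemma measurable_traj A j n s : measurable (traj_event A j n s).
Proof.
apply: measurableI.
  apply: (@bigcap_measurableType _ _ (fun m => [set w | A (X m w)]) [set m | (m < j)%N]) => m _.
  exact: (measurable_discrete (mX m) (fun z => A z)).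
apply: (@bigcap_measurableType _ _ (fun k => [set w | X k w = s k]) [set k | (j <= k <= n)%N]) => k _.
exact: mX.
Qed.

(** Raising [j] by one sums over the value of [X j]; only the finitely many neighbours of [s j.+1]
    contribute, and the sum is the recursion defining [path_weight]. *)
Lemma traj_prob A x j n s : (j <= n)%N ->
  P x (traj_event A j n s) =
  (path_weight A x j (s j) * \prod_(j <= k < n) K (s k) (s k.+1))%:E.
Proof.
elim: j s => [|j IH] s jn.
  rewrite big_mkord /= eq_sym; case: hX => _ <-; congr (P x _).
  by apply/seteqP; split=> w; [case=> _ H k kn; exact: H|move=> H; split].
pose s' z k := if k == j then z else s k.
have step z : traj_event A j.+1 n s `&` [set w | X j w = z] =
    if A z then traj_event A j n (s' z) else set0.
  apply/seteqP; split=> w.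
    case=> -[H1 H2] /= Xz; have := H1 j (ltnSn j); rewrite Xz => ->; split.
      by move=> m mj; apply: H1; rewrite ltnS ltnW.
    move=> k /andP[jk kn]; rewrite /s'; case: eqP => [->//|/eqP kj].
    by apply: H2; rewrite kn andbT ltn_neqAle eq_sym kj.
  case: ifP => // Az [H1 H2]; have Xz : X j w = z.
    by rewrite H2 ?leqnn 1?ltnW // /s' eqxx.
  split=> //; split=> [m|k /andP[jk kn]].
    by rewrite ltnS leq_eqVlt => /predU1P[->|/H1//]; rewrite Xz.
  by rewrite H2 /s' ?kn ?(ltnW jk) // gtn_eqF.
have val z : P x (traj_event A j.+1 n s `&` [set w | X j w = z]) =
    ((A z)%:R * path_weight A x j z * K z (s j.+1) *
      \prod_(j.+1 <= k < n) K (s k) (s k.+1))%:E.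
  rewrite step; case: (A z); last by rewrite measure0 !mul0r.
  rewrite IH 1?ltnW // mul1r /s' eqxx big_ltn // eqxx.
  rewrite gtn_eqF // -mulrA; congr ((_ * (_ * _))%:E).
  apply: eq_big_nat => k /andP[jk kn]; rewrite !gtn_eqF //.
  exact: leq_trans jk _.
rewrite (@measure_fibers_seq _ _ _ _ (X j) (mX j) _ _
  (parent (s j.+1) :: children nb (s j.+1))).
- rewrite (eq_bigr _ (fun z _ => val z)).
  by rewrite sumEFin -big_distrl /= -path_weight_nbrs.
- exact: measurable_traj.
- by rewrite /= parent_notin_children // children_uniq.
- by move=> z zn; apply: etrans (val z) _; rewrite (K_eq0 _ _ nbE zn) mulr0 mul0r.
Qed.

Lemma path_weight_prob A x n y :
  P x [set w | X n w = y /\ forall m, (m < n)%N -> A (X m w)] = (path_weight A x n y)%:E.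
Proof.
have := @traj_prob A x n n (fun=> y) (leqnn n).
rewrite big_geq // mulr1 => <-; congr (P x _).
apply/seteqP; split=> w /=.
  by case=> <- H; split=> // k; rewrite -eqn_leq => /eqP <-.
by case=> H1 H2; split=> //; apply: H2; rewrite leqnn.
Qed.

Lemma walk_law_prob n y : P o [set w | X n w = y] = (walk_law n y)%:E.
Proof.
rewrite walk_lawE -path_weight_prob; congr (P o _).
by apply/seteqP; split=> w //= [].
Qed.

Lemma two_step_prob n y z :
  P o [set w | X n w = y /\ X n.+1 w = z] = (walk_law n y * K y z)%:E.
Proof.
have := @traj_prob predT o n n.+1 (fun k => if k == n then y else z) (leqnSn n).
rewrite big_nat1 eqxx gtn_eqF // => <-; congr (P o _).
apply/seteqP; split=> w /=.
  case=> H1 H2; split=> // k; case: eqP => [->//|/eqP kn].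
  by move=> /andP[nk kn1]; have -> : k = n.+1 by apply/eqP; lia.
case=> _ H; split; first by rewrite H ?leqnn ?leqnSn // eqxx.
by rewrite H ?leqnSn ?leqnn // gtn_eqF.
Qed.

Lemma law_atE n y : law_at P X o n y = walk_law n y.
Proof. by rewrite /law_at walk_law_prob. Qed.

Lemma walk_law_le1 n y : walk_law n y <= 1.
Proof. by rewrite -lee_fin -walk_law_prob probability_le1 //; exact: mX. Qed.

Lemma walk_law_sum n : \sum_(y <- tball E i0 nb n) walk_law n y = 1.
Proof.
apply: EFin_inj; rewrite -(@probability_setT _ _ _ (P o)).
rewrite (@measure_fibers_seq _ _ _ _ (X n) (mX n) _ _ (tball E i0 nb n)) //.
- by rewrite -sumEFin; apply: eq_bigr => y _; rewrite setTI; exact/esym/walk_law_prob.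
- exact: tball_uniq.
- move=> y; rewrite mem_tball // -ltnNge => yn.
  by rewrite setTI; apply: etrans (walk_law_prob n y) _; rewrite walk_law_level.
Qed.

Lemma ae_step : {ae P o, forall w, forall n, 0 < K (X n w) (X n.+1 w)}.
Proof.
have neg n yz : (P o).-negligible [set w | [/\ K yz.1 yz.2 = 0, X n w = yz.1 & X n.+1 w = yz.2]].
  have [K0|K0] := eqVneq (K yz.1 yz.2) 0; last first.
    exists set0; split=> // w [] /eqP; by rewrite (negPf K0).
  exists [set w | X n w = yz.1 /\ X n.+1 w = yz.2]; split.
  - by apply: measurableI; exact: mX.
  - by rewrite two_step_prob K0 mulr0.
  - by move=> w [].
pose F n k := if pickle_inv k is Some yz then
  [set w | [/\ K yz.1 yz.2 = 0, X n w = yz.1 & X n.+1 w = yz.2]] else set0.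
have negF n : (P o).-negligible (\bigcup_k F n k).
  apply: negligible_bigcup => k; rewrite /F; case: pickle_inv => [yz|].
    exact: neg.
  exact: negligible_set0.
apply: negligibleS (negligible_bigcup negF) => w /= /existsNP[n /negP K0].
exists n => //; exists (choice.pickle (X n w, X n.+1 w)) => //.
rewrite /F pickleK_inv /=; split=> //; apply/eqP; rewrite eq_le K_ge0 // andbT.
by rewrite leNgt.
Qed.

Lemma ae_adj : {ae P o, forall w, forall n,
  [\/ is_child (X n w) (X n.+1 w), is_child (X n.+1 w) (X n w) |
      X n w = o /\ X n.+1 w = o]}.
Proof. by apply: filterS ae_step => w H n; exact: (K_gt0_adj (H n)). Qed.

End chain.

(** * Green function and limiting ray *)

Section green.
Variables (R : realType) (G : countType) (E : rel G) (i0 : G) (nb : G -> seq G).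
Variables (pG : G -> G -> R) (pback : G -> R).
Hypothesis nbE : forall i j, (j \in nb i) = E i j.
Hypothesis nb_uniq : forall i, uniq (nb i).
Hypothesis pfwd0 : forall i j, 0 <= pfwd pG pback i j.
Hypothesis pfwdE : forall i j, E i j -> 0 < pfwd pG pback i j.
Variables (e C r : R).
Hypothesis e0 : 0 < e.
Hypothesis eb : forall i, e <= pback i.
Local Notation T := (dcover E i0).
Local Notation o := (cover_root E i0).
Local Notation K := (@walk_kernel R G E i0 pG pback).
Local Notation path_weight := (path_weight nb pG pback).
Local Notation walk_law := (@walk_law R G E i0 nb pG pback).
Hypothesis r01 : 0 < r < 1.
Hypothesis walk_law_geo : forall n, walk_law n o <= C * r ^+ n.
Variables (d : measure_display) (Omega : measurableType d).
Variables (P : T -> probability Omega R) (X : nat -> Omega -> T).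
Hypothesis hX : markov_chain K P X.
Hypothesis reprP : forall i, exists2 x : T, x != o & tau x = i.
Local Notation Fb := (@Fback R G E i0 d Omega P X).
Local Notation Gb := (@Gbar R G E i0 d Omega P X).
Local Notation q := (@exit_kernel R G E i0 pG pback d Omega P X).
Implicit Types (x y z : T) (A : pred T).

Let pback0 i : 0 <= pback i. Proof. exact: le_trans (ltW e0) (eb i). Qed.

Lemma walk_law_ge0 n y : 0 <= walk_law n y. Proof. exact: path_weight_ge0. Qed.

Lemma walk_law_geo_at n y : walk_law n y <= C * (r / e) ^+ level y * r ^+ n.
Proof.
have := le_trans (walk_law_root nbE pfwd0 pback0 n y (ltW e0) eb) (walk_law_geo _).
rewrite -ler_pdivlMr ?exprn_gt0 //; move=> /le_trans; apply.
by rewrite exprD expr_div_n -!mulrA ![r ^+ n * _]mulrC -!mulrA.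
Qed.

Lemma series_walk_law_cvg y : cvgn (series (walk_law ^~ y)).
Proof.
case/andP: r01 => r0 r1.
apply: (@geometric_bound_cvg _ _ (C * (r / e) ^+ level y) r).
  by rewrite r1 ltW.
by move=> n; rewrite walk_law_ge0 walk_law_geo_at.
Qed.

Definition green y : R := limn (series (walk_law ^~ y)).

Lemma walk_law_cvg0 y : (fun n => walk_law n y) @ \oo --> 0.
Proof. by have := cvg_series_cvg_0 (@series_walk_law_cvg y). Qed.

Lemma walk_law_gt0 y : 0 < walk_law (level y) y.
Proof.
have [n] := ubnP (level y); elim: n y => // n IH y yn.
have [->|y0] := eqVneq y o; first by rewrite level_root walk_lawE /= ltr0n.
rewrite (level_parentS y0) walk_lawE /= mul1r ltr_wpDr //.
  by apply: sumr_ge0 => j _; rewrite !mulr_ge0 // path_weight_ge0.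
rewrite mulr_gt0 //; first by apply: IH; move: yn; rewrite (level_parentS y0).
by rewrite K_parent // pfwdE // edge_parent.
Qed.

Lemma green_gt0 y : 0 < green y.
Proof.
apply: lt_le_trans (walk_law_gt0 y) _.
apply: (@nneg_series_ge _ (walk_law ^~ y)); last exact: series_walk_law_cvg.
by move=> n; exact: walk_law_ge0.
Qed.

Section vertex.
Variable x : T.
Hypothesis x0 : x != o.
Local Notation A := (predC1 (parent x)).
Local Notation g := (fun n => path_weight A x n x).

Let g0 n : 0 <= g n. Proof. exact: path_weight_ge0. Qed.

Let Kpx : 0 < K (parent x) x.
Proof. by rewrite K_parent // pfwdE // edge_parent. Qed.

(** In the last-exit decomposition of [walk_law (m.+1 + n) x], the single summand at time
    [m = level (parent x)] is a positive constant times [g n], and the left side decays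
    geometrically. *)
Lemma series_killed_cvg : cvgn (series g).
Proof.
case/andP: r01 => r0 r1; set m := level (parent x).
have c0 : 0 < walk_law m (parent x) * K (parent x) x by rewrite mulr_gt0 ?walk_law_gt0.
apply: (@geometric_bound_cvg _ _ (C * (r / e) ^+ level x * r ^+ m.+1 /
   (walk_law m (parent x) * K (parent x) x)) r); first by rewrite r1 ltW.
move=> n; rewrite g0 /= mulrAC ler_pdivlMr // -[leRHS]mulrA -exprD.
apply: le_trans (walk_law_geo_at _ _).
rewrite [leRHS](path_weight_conv _ _ nbE x0); last by rewrite anc_id.
have mn : (m < m.+1 + n)%N by lia.
rewrite (bigD1 (Ordinal mn)) //= addKn mulrC lerDl.
by apply: sumr_ge0 => k _; rewrite !mulr_ge0 ?walk_law_ge0 ?path_weight_ge0 // ltW.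
Qed.

(** Summed over time, the last-exit decomposition becomes a product of series: G(o,x) = G(o,x^-)
    p(x^-,x) times the Green function killed at x^-. *)
Lemma green_parent : green x = green (parent x) * K (parent x) x * limn (series g).
Proof.
pose a n := walk_law n (parent x) * K (parent x) x.
have a0 n : 0 <= a n by rewrite mulr_ge0 ?walk_law_ge0 // ltW.
have aE : series a = (fun n => series (walk_law ^~ (parent x)) n * K (parent x) x).
  by apply/funext => n; rewrite /series /= big_distrl.
have ca : series a @ \oo --> green (parent x) * K (parent x) x.
  by rewrite aE; apply: cvgM; [exact: series_walk_law_cvg|exact: cvg_cst].
have := @cauchy_product_cvg R a g a0 g0 (cvgP _ ca) series_killed_cvg.
rewrite (cvg_lim _ ca) // => H; rewrite /green; apply: cvg_lim => //.
rewrite (_ : series _ = (fun N => \sum_(n < N) a n * series g (N - n.+1)%N)) //.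
apply/funext => N; apply: cauchy_product_series => M.
by rewrite (path_weight_conv _ _ nbE x0) // anc_id.
Qed.

Lemma prob_killed n : P x [set w | X n w = x /\ forall m, (m < n)%N -> X m w <> parent x]
  = (path_weight A x n x)%:E.
Proof.
rewrite -(path_weight_prob nbE nb_uniq hX); congr (P x _).
by apply/seteqP; split=> w [H1 H2]; split=> // m mn; apply/eqP; exact: H2.
Qed.

(** Split according to the first hitting time of [parent x]. Time 0 is impossible, and a first hit
    at [n.+1] means being at [x] at time [n], unkilled, and then stepping back; hence the shift of
    the series. *)
Lemma prob_exit : P x [set w | exists n, X n w = parent x] =
  (pback (tau x) * limn (series g))%:E.
Proof.
pose F n := [set w | X n w = parent x /\ forall m, (m < n)%N -> A (X m w)].
have FE : [set w | exists n, X n w = parent x] = \bigcup_n F n.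
  apply/seteqP; split=> w /=; last by case=> n _ [Xn _]; exists n.
  case=> n0 Xn0.
  have ex : exists n, X n w == parent x by exists n0; rewrite Xn0.
  exists (ex_minn ex) => //; case: ex_minnP => n /eqP Xn nmin; split=> // m mn.
  by apply/negP => /nmin; rewrite leqNgt mn.
have mF n : measurable (F n).
  rewrite (_ : F n = traj_event X A n n (fun=> parent x)).
    exact: measurable_traj hX _ _ _ _.
  apply/seteqP; split=> w /=.
    by case=> Xn H; split=> // k; rewrite -eqn_leq => /eqP <-.
  by case=> H1 H2; split=> //; apply: H2; rewrite leqnn.
rewrite FE measure_semi_bigcup //; last first.
- exact: bigcupT_measurable.
- move=> n m _ _ [w [Fn Fm]]; case: Fn => Xn Hn; case: Fm => Xm Hm.
  case: (ltngtP n m) => [nm|mn|//].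
    by have := Hm n nm; rewrite [A _]/= Xn eqxx.
  by have := Hn m mn; rewrite [A _]/= Xm eqxx.
rewrite (eq_eseriesr (g := fun n => (path_weight A x n (parent x))%:E)); last first.
  by move=> n _; apply: etrans (path_weight_prob nbE nb_uniq hX _ _ _ _) _.
apply/cvg_lim => //.
rewrite (_ : (fun n => _) = EFin \o series (fun n => path_weight A x n (parent x))); last first.
  by apply/funext => n; rewrite /= /series /= sumEFin.
apply: cvg_EFin; first exact: nearW.
rewrite /= -cvg_shiftS.
rewrite (_ : (fun n => _) = (fun n => pback (tau x) * series g n)).
  by apply: cvgM; [exact: cvg_cst|exact: series_killed_cvg].
apply/funext => n; rewrite /series /= big_nat_recl //=.
rewrite -[X in X + _]/((x == parent x)%:R).
rewrite (negPf (subtree_neq x0 _)) ?anc_id // add0r big_distrr /=.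
apply: eq_bigr => k _; rewrite [RHS]mulrC.
exact: (path_weight_exit pG pback nbE nb_uniq x0).
Qed.

End vertex.

Lemma repr_vertexP i : repr_vertex E i0 i != o /\ tau (repr_vertex E i0 i) = i.
Proof.
rewrite /repr_vertex; case: xgetP => [x -> //|H].
by have [x x0 xi] := reprP i; case: (H x).
Qed.

Lemma killed_label x y n : x != o -> y != o -> tau x = tau y ->
  path_weight (predC1 (parent x)) x n x = path_weight (predC1 (parent y)) y n y.
Proof.
by move=> x0 y0 xy; apply: (path_weight_label _ _ nbE n (s := [::])); rewrite ?cats0.
Qed.

Lemma Gb_killed x : x != o ->
  Gb (tau x) = limn (series (fun n => path_weight (predC1 (parent x)) x n x)).
Proof.
move=> x0; have [y0 yx] := repr_vertexP (tau x); rewrite /Gbar.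
rewrite (eq_eseriesr (g := fun n => (path_weight (predC1 (parent x)) x n x)%:E)); last first.
  move=> n _; apply: etrans (prob_killed _ n) _; congr EFin.
  exact: killed_label.
rewrite (_ : (\sum_(0 <= n <oo) _)%E =
  (limn (series (fun n => path_weight (predC1 (parent x)) x n x)))%:E) //.
apply/cvg_lim => //.
rewrite (_ : (fun n => _) = EFin \o series (fun n => path_weight (predC1 (parent x)) x n x)); last first.
  by apply/funext => n; rewrite /= /series /= sumEFin.
by apply: cvg_EFin; [exact: nearW|exact: series_killed_cvg].
Qed.

Lemma FbE i : Fb i = pback i * Gb i.
Proof.
have [y0 yi] := repr_vertexP i.
rewrite /Fback; set z := repr_vertex E i0 i in y0 yi *.
transitivity (fine (pback (tau z) * Gb (tau z))%:E); last by rewrite yi.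
by congr fine; apply: etrans (prob_exit y0) _; rewrite -Gb_killed.
Qed.

Lemma Fb_le1 i : Fb i <= 1.
Proof.
have [y0 _] := repr_vertexP i.
rewrite /Fback -lee_fin fineK; last by rewrite prob_exit.
apply: probability_le1.
rewrite (_ : [set w | _] = \bigcup_n [set w | X n w = parent (repr_vertex E i0 i)]).
  by apply: bigcupT_measurable => n; exact: mX hX _ _.
by apply/seteqP; split=> w /= [n]; [exists n|move=> _; exists n].
Qed.

Lemma Gb_ge1 i : 1 <= Gb i.
Proof.
have [y0 yi] := repr_vertexP i; rewrite -[X in Gb X]yi Gb_killed //.
set u := fun n => _; have -> : 1 = u 0%N by rewrite /u /= eqxx.
apply: nneg_series_ge; first by move=> n; exact: path_weight_ge0.
exact: series_killed_cvg.
Qed.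

Hypothesis Fb1 : forall i, Fb i <> 1.

Lemma Fb_lt1 i : Fb i < 1.
Proof. by rewrite lt_neqAle Fb_le1 andbT; apply/eqP. Qed.

Lemma q_ge0 i j : 0 <= q i j.
Proof.
rewrite /exit_kernel; apply: mulr_ge0; first apply: mulr_ge0 => //.
  by rewrite mulr_ge0 ?invr_ge0 ?subr_ge0 ?Fb_le1.
exact: le_trans ler01 (Gb_ge1 i).
Qed.

Lemma q_gt0 i j : E i j -> 0 < q i j.
Proof.
move=> ij; rewrite /exit_kernel; apply: mulr_gt0; first (apply: mulr_gt0; last exact: pfwdE).
  by rewrite mulr_gt0 ?invr_gt0 ?subr_gt0 ?Fb_lt1.
exact: lt_le_trans ltr01 (Gb_ge1 i).
Qed.

(* The limit law, as n tends to infinity, of the ancestor of X_n at level |x|. *)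
Definition exit_law x : R := green (parent x) * K (parent x) x * (1 - Fb (tau x)).

Lemma exit_law_gt0 x : x != o -> 0 < exit_law x.
Proof.
move=> x0; rewrite /exit_law mulr_gt0 ?subr_gt0 ?Fb_lt1 // mulr_gt0 ?green_gt0 //.
by rewrite K_parent // pfwdE // edge_parent.
Qed.

(** By [green_parent] the Green function at [x] produces the factor [Gbar], and the factors [1 - F]
    form the ratio in [q]. So [q] is the transition matrix of the labels along the limiting ray. *)
Lemma exit_law_ext x j : x != o -> E (tau x) j -> exit_law (ext x j) = exit_law x * q (tau x) j.
Proof.
move=> x0 xj; rewrite {1}/exit_law K_parent ?ext_root // parent_ext // /exit_law.
rewrite tau_ext // green_parent // -Gb_killed // /exit_kernel.
by field; rewrite gt_eqF // subr_gt0 Fb_lt1.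
Qed.

(** * The mass of a subtree at time N and its limit *)

Definition subtree_prob N x : R :=
  fine (P o [set w | anc (level x) (X N w) = x]).

Lemma measurable_anc N L x : measurable [set w | anc L (X N w) = x].
Proof. exact: (measurable_discrete (mX hX N) (fun z => anc L z = x)). Qed.

Lemma subtree_probE N x : P o [set w | anc (level x) (X N w) = x] =
  (subtree_prob N x)%:E.
Proof.
by rewrite /subtree_prob fineK // fin_num_measure //; exact: measurable_anc.
Qed.

Lemma anc_child_eq x y z : x != o -> is_child y z -> y != parent x ->
  (anc (level x) y = x) <-> (anc (level x) z = x).
Proof.
move=> x0 /andP[z0 /eqP zy] ypx; rewrite -zy parent_anc.
rewrite -zy parent_anc in ypx.
have [xz|zx] := leqP (level x) (level z).-1; first by rewrite anc_anc.
have zlex : (level z <= level x)%N by lia.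
rewrite (anc_id zlex) anc_id; last by rewrite level_anc; lia.
split=> [|zex]; last by move: ypx; rewrite zex -parent_anc eqxx.
move=> /(congr1 (@level _ _ _)); rewrite level_anc => ex.
have := cover_root_level x; rewrite (negPf x0); lia.
Qed.

Lemma anc_sibling x z : x != o -> is_child (parent x) z ->
  (anc (level x) z = x) <-> z = x.
Proof.
move=> x0 /level_child zx; rewrite anc_id // zx.
by rewrite -(level_parentS x0).
Qed.

(** The subtree of [x] can be entered or left only through the edge between [x] and [parent x].
    Inflow and outflow are put on opposite sides so that both appear as disjoint unions. *)
Lemma subtree_step x y z : x != o ->
  [\/ is_child y z, is_child z y | y = o /\ z = o] ->
  (anc (level x) z = x \/ (y = x /\ z = parent x)) <->
  (anc (level x) y = x \/ (y = parent x /\ z = x)).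
Proof.
move=> x0; have xx : anc (level x) x = x by rewrite anc_id.
have px : anc (level x) (parent x) <> x by apply/eqP; exact: anc_parentx.
case=> [yz|zy|[-> ->]].
- have [yp|yp] := eqVneq y (parent x).
    rewrite yp in yz *; have := anc_sibling x0 yz => sib; split.
      by case=> [/sib ->|[e1 e2]]; [right|case: px; rewrite e1].
    by case=> [//|[_ ->]]; left.
  have H := anc_child_eq x0 yz yp; split.
    by case=> [/H|[->]] //; left.
  case=> [/H|[e1]]; first by left.
  by rewrite e1 eqxx in yp.
- have [zp|zp] := eqVneq z (parent x).
    rewrite zp in zy *; have := anc_sibling x0 zy => sib; split.
      by case=> [//|[-> _]]; left.
    by case=> [/sib ->|[e1 e2]]; [right|case: px; rewrite e2].
  have H := anc_child_eq x0 zy zp; split.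
    case=> [/H|[_ e1]]; first by left.
    by rewrite e1 eqxx in zp.
  by case=> [/H|[_ ->]]; left.
- split; case=> [|[e1 e2]]; try by left.
    by rewrite -e1 eqxx in x0.
  by rewrite -e2 eqxx in x0.
Qed.

Lemma ae_le_prob (A B : set Omega) : measurable A -> measurable B ->
  {ae P o, forall w, A w -> B w} -> (P o A <= P o B)%E.
Proof.
move=> mA mB [N [mN PN HN]]; rewrite -[leRHS]adde0 -PN.
apply: le_trans (measureU2 _ _ _) => //.
apply: le_measure; rewrite ?inE //; first exact: measurableU.
move=> w Aw; have [Bw|Bw] := pselect (B w); [left|right] => //.
by apply: HN => /= /(_ Aw).
Qed.

Lemma ae_eq_prob (A B : set Omega) : measurable A -> measurable B ->
  {ae P o, forall w, A w <-> B w} -> P o A = P o B.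
Proof.
move=> mA mB AB; apply/eqP; rewrite eq_le !ae_le_prob //.
  by apply: filterS AB => w [].
by apply: filterS AB => w [].
Qed.

Lemma subtree_prob_rec N x : x != o ->
  subtree_prob N.+1 x + walk_law N x * pback (tau x) =
  subtree_prob N x + walk_law N (parent x) * K (parent x) x.
Proof.
move=> x0; apply: EFin_inj; rewrite !EFinD -!subtree_probE.
have mY n y : measurable [set w | X n w = y] by exact: mX hX n y.
have mYY n y z : measurable [set w | X n w = y /\ X n.+1 w = z].
  by apply: measurableI; exact: mY.
have xpx : x <> parent x.
  by apply/eqP/(subtree_neq x0); rewrite anc_id.
have px : anc (level x) (parent x) <> x by apply/eqP; exact: anc_parentx.
have -> : (walk_law N x * pback (tau x))%:E =
    P o [set w | X N w = x /\ X N.+1 w = parent x].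
  by rewrite (two_step_prob nbE nb_uniq hX) K_child // /is_child x0 eqxx.
rewrite -(two_step_prob nbE nb_uniq hX).
rewrite -!measureU //; try exact: measurable_anc.
- apply: ae_eq_prob; try by apply: measurableU => //; exact: measurable_anc.
  apply: filterS (ae_adj nbE nb_uniq pfwd0 pback0 hX) => w /(_ N) H.
  exact: subtree_step.
- apply/seteqP; split=> w //= [H [H1 _]]; apply: px.
  by rewrite -H1.
- apply/seteqP; split=> w //= [H [_ H1]]; apply: px.
  by rewrite -H1.
Qed.

Lemma subtree_prob0 x : x != o -> subtree_prob 0 x = 0.
Proof.
move=> x0; rewrite /subtree_prob.
have : (P o [set w | anc (level x) (X 0 w) = x] <= P o (~` [set w | X 0 w = o]))%E.
  apply: le_measure; rewrite ?inE; first exact: measurable_anc.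
    by apply: measurableC; exact: mX hX _ _.
  move=> w /= H Xo; move: H; rewrite Xo anc_id // => xo.
  by rewrite -xo eqxx in x0.
rewrite probability_setC; last exact: mX hX _ _.
have n0 : walk_law 0 o = 1 by rewrite walk_lawE /=.
rewrite (walk_law_prob nbE nb_uniq hX) n0 subee // => H.
by apply/eqP; rewrite -eqe fineK ?fin_num_measure //; [rewrite eq_le H measure_ge0|exact: measurable_anc].
Qed.

Lemma subtree_prob_sum N x : x != o -> subtree_prob N x =
  series (walk_law ^~ (parent x)) N * K (parent x) x -
  series (walk_law ^~ x) N * pback (tau x).
Proof.
move=> x0; elim: N => [|N IH].
  by rewrite subtree_prob0 // /series /= !big_geq // !mul0r subr0.
have S (u : R^nat) : series u N.+1 = series u N + u N.
  by rewrite /series /= big_nat_recr.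
have := subtree_prob_rec N x0; rewrite IH !S; lra.
Qed.

(** Total inflow minus total outflow through the edge above [x]; [green_parent] and F(-i) = p(-i)
    Gbar_i put the difference in the form [exit_law x]. *)
Lemma subtree_prob_cvg x : x != o -> (fun N => subtree_prob N x) @ \oo --> exit_law x.
Proof.
move=> x0; under eq_fun do rewrite subtree_prob_sum //.
have -> : exit_law x = green (parent x) * K (parent x) x - green x * pback (tau x).
  by rewrite /exit_law FbE (green_parent x0) -Gb_killed //; ring.
apply: cvgB; apply: cvgM; try exact: cvg_cst; exact: series_walk_law_cvg.
Qed.

Lemma anc_tree_prob N L y : (level y <= L)%N ->
  fine (P o [set w | anc L (X N w) = y]) =
  if level y == L then subtree_prob N y else walk_law N y.
Proof.
move=> yL; case: eqP => [<- //|/eqP yL'].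
rewrite -[RHS]/(fine (walk_law N y)%:E) -(walk_law_prob nbE nb_uniq hX); congr fine.
congr (P o _); apply/seteqP; split=> w /= [H]; last first.
  by rewrite H anc_id.
move: (congr1 (@level _ _ _) H); rewrite level_anc => lv.
by rewrite -H anc_id //; lia.
Qed.

Lemma anc_sum N L : \sum_(y <- tball E i0 nb L)
  fine (P o [set w | anc L (X N w) = y]) = 1.
Proof.
apply: EFin_inj; rewrite -(@probability_setT _ _ _ (P o)).
rewrite (@measure_fibers_seq _ _ _ _ (fun w => anc L (X N w)) (measurable_anc N L) _ _ (tball E i0 nb L)) //.
- rewrite -sumEFin; apply: eq_bigr => y _; rewrite setTI fineK //.
  by rewrite fin_num_measure //; exact: measurable_anc.
- exact: tball_uniq.
- move=> y; rewrite mem_tball // -ltnNge => yL.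
  rewrite setTI (_ : [set w | _] = set0) ?measure0 //.
  apply/seteqP; split=> w //= H; move: yL; rewrite -H level_anc; lia.
Qed.

(** No mass is lost in the limit: the sphere is finite, and the probability of being in the ball
    strictly inside it tends to 0. *)
Lemma sum_exit_law L : (0 < L)%N -> \sum_(x <- lev E i0 nb L) exit_law x = 1.
Proof.
case: L => // L _.
have H N : \sum_(x <- lev E i0 nb L.+1) subtree_prob N x =
    1 - \sum_(y <- tball E i0 nb L) walk_law N y.
  rewrite -(anc_sum N L.+1) big_tball addrAC -sumrB [X in _ = X + _](_ : _ = 0) ?add0r.
    apply: eq_big_seq => x; rewrite mem_lev // => /eqP xL.
    by rewrite anc_tree_prob ?xL // eqxx.
  rewrite big_seq big1 // => y; rewrite mem_tball // => yL.
  by rewrite anc_tree_prob 1?ltnW // ltn_eqF ?subrr // ltnS.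
have c1 : (fun N => \sum_(x <- lev E i0 nb L.+1) subtree_prob N x) @ \oo -->
    \sum_(x <- lev E i0 nb L.+1) exit_law x.
  apply: cvg_sum_seq => x; rewrite mem_lev // => /eqP xL.
  by apply: subtree_prob_cvg; rewrite cover_root_level xL.
have c2 : (fun N => 1 - \sum_(y <- tball E i0 nb L) walk_law N y) @ \oo --> 1 - \sum_(y <- tball E i0 nb L) (0 : R).
  apply: cvgB; first exact: cvg_cst.
  by apply: cvg_sum_seq => y _; exact: walk_law_cvg0.
rewrite big1 // subr0 in c2; rewrite (funext H) in c1.
exact: (cvg_unique _ c1 c2).
Qed.

Lemma subtree_prob_ext N x :
  subtree_prob N x = walk_law N x + \sum_(j <- nb (tau x)) subtree_prob N (ext x j).
Proof.
apply: EFin_inj; rewrite -subtree_probE.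
rewrite (@measure_fibers_seq _ _ _ _ (fun w => anc (level x).+1 (X N w))
  (measurable_anc N _) _ _ (x :: children nb x)).
- rewrite big_cons big_map EFinD -sumEFin; congr (_ + _)%E.
    apply: etrans (walk_law_prob nbE nb_uniq hX _ _); congr (P o _).
    apply/seteqP; split=> w /=.
      case=> _ H; move: (congr1 (@level _ _ _) H); rewrite level_anc => lv.
      by rewrite -H anc_id //; lia.
    by move=> ->; rewrite !anc_id.
  apply: eq_big_seq => j; rewrite nbE => xj; rewrite -subtree_probE level_ext //.
  congr (P o _); apply/seteqP; split=> w /=; first by case.
  move=> H; split=> //; have := congr1 (anc (level x)) H.
  by rewrite anc_anc // => ->; rewrite anc_ext // anc_id.
- exact: measurable_anc.
- rewrite /= (children_uniq nbE) // andbT (mem_children nbE).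
  by apply/negP => /is_child_neq; rewrite eqxx.
- move=> y; rewrite inE negb_or (mem_children nbE) => /andP[yx yc].
  rewrite (_ : _ `&` _ = set0) ?measure0 //; apply/seteqP; split=> w //= [H1 H2].
  have yanc : anc (level x) y = x by rewrite -H2 anc_anc.
  have lv := congr1 (@level _ _ _) H2; rewrite level_anc in lv.
  have [yl|yl] := leqP (level y) (level x).
    by rewrite anc_id // in yanc; rewrite yanc eqxx in yx.
  case/negP: yc; rewrite /is_child cover_root_level -lt0n (leq_ltn_trans _ yl) //=.
  apply/eqP; rewrite parent_anc -[RHS]yanc; congr anc; lia.
Qed.

(** In the limit the mass of the subtree of [x] splits among the children, as the probability of
    being at [x] tends to 0; then divide by [exit_law x > 0]. *)
Lemma sum_q i : \sum_(j <- nb i) q i j = 1.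
Proof.
have [x x0 xi] := reprP i; rewrite -xi.
have m0 := exit_law_gt0 x0.
have : exit_law x = \sum_(j <- nb (tau x)) exit_law (ext x j).
  have c1 := subtree_prob_cvg x0.
  have c2 : (fun N => walk_law N x + \sum_(j <- nb (tau x)) subtree_prob N (ext x j)) @ \oo -->
      0 + \sum_(j <- nb (tau x)) exit_law (ext x j).
    apply: cvgD; first exact: walk_law_cvg0.
    apply: cvg_sum_seq => j; rewrite nbE => xj; apply: subtree_prob_cvg.
    exact: ext_root.
  rewrite add0r in c2; rewrite (funext (fun N => subtree_prob_ext N x)) in c1.
  exact: (cvg_unique _ c1 c2).
rewrite (eq_big_seq (fun j => exit_law x * q (tau x) j)); last first.
  by move=> j; rewrite nbE => xj; rewrite exit_law_ext.
rewrite -big_distrr /= -[X in X = _]mulr1.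
by move/(mulfI (lt0r_neq0 m0)) => <-.
Qed.

End green.

(** * Entropies of the walk and of its ancestors *)

Section comparison.
Variables (R : realType) (G : countType) (E : rel G) (i0 : G) (nb : G -> seq G).
Variables (pG : G -> G -> R) (pback : G -> R) (D : nat).
Hypothesis nbE : forall i j, (j \in nb i) = E i j.
Hypothesis nb_uniq : forall i, uniq (nb i).
Hypothesis nbD : forall i, (size (nb i) <= D)%N.
Hypothesis pfwd0 : forall i j, 0 <= pfwd pG pback i j.
Hypothesis pback0 : forall i, 0 <= pback i.
Local Notation T := (dcover E i0).
Local Notation o := (cover_root E i0).
Local Notation K := (@walk_kernel R G E i0 pG pback).
Local Notation walk_law := (@walk_law R G E i0 nb pG pback).
Local Notation tball := (tball E i0 nb).
Variables (d : measure_display) (Omega : measurableType d).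
Variables (P : T -> probability Omega R) (X : nat -> Omega -> T).
Hypothesis hX : markov_chain K P X.
Implicit Types (x y z : T).

Local Notation pr B := (fine (P o B)).

Lemma pr_ge0 (B : set Omega) : 0 <= pr B.
Proof. by rewrite fine_ge0. Qed.

Lemma prE (B : set Omega) : measurable B -> P o B = (pr B)%:E.
Proof. by move=> mB; rewrite fineK // fin_num_measure. Qed.

Lemma pr_fibers_walk n (B : set Omega) : measurable B ->
  pr B = \sum_(a <- tball n) pr (B `&` [set w | X n w = a]).
Proof.
move=> mB; apply: EFin_inj; rewrite -prE //.
rewrite (@measure_fibers_seq _ _ _ _ _ (mX hX n) _ _ (tball n)) //.
- rewrite -sumEFin; apply: eq_bigr => y _; apply: prE.
  by apply: measurableI => //; exact: mX hX _ _.
- exact: tball_uniq.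
- move=> y; rewrite mem_tball // -ltnNge => yn; apply/eqP.
  rewrite eq_le measure_ge0 andbT.
  apply: (@le_trans _ _ (P o [set w | X n w = y])).
    apply: le_measure; rewrite ?inE; last by move=> w [].
      by apply: measurableI => //; exact: mX hX _ _.
    exact: mX hX _ _.
  by rewrite (walk_law_prob nbE nb_uniq hX) walk_law_level.
Qed.

Lemma pr_fibers_anc N L (B : set Omega) : measurable B ->
  pr B = \sum_(b <- tball L) pr (B `&` [set w | anc L (X N w) = b]).
Proof.
move=> mB; apply: EFin_inj; rewrite -prE //.
rewrite (@measure_fibers_seq _ _ _ _ (fun w => anc L (X N w)) (measurable_anc hX N L) _ _ (tball L)) //.
- rewrite -sumEFin; apply: eq_bigr => y _; apply: prE.
  by apply: measurableI => //; exact: measurable_anc hX _ _ _.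
- exact: tball_uniq.
- move=> y; rewrite mem_tball // -ltnNge => yL.
  rewrite (_ : _ `&` _ = set0) ?measure0 //.
  apply/seteqP; split=> w //= [_ H]; move: yL; rewrite -H level_anc.
  by rewrite ltnNge geq_minl.
Qed.

Definition walk_entropy n : R := \sum_(y <- tball n) eta (walk_law n y).
Definition anc_entropy N L : R :=
  \sum_(b <- tball L) eta (pr [set w | anc L (X N w) = b]).

Variable ell0 : R.

(** Every time [m >= n] is included: the events then decrease with [n], and off [bad dl n] the walk
    never goes back below a given level after time [n]. *)
Definition bad (dl : R) n : set Omega := [set w | exists2 m, (n <= m)%N &
  dl * m%:R < `| (level (X m w))%:R - ell0 * m%:R |].

Lemma measurable_bad dl n : measurable (bad dl n).
Proof.
rewrite (_ : bad dl n = \bigcup_(m in [set m | (n <= m)%N])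
  [set w | dl * m%:R < `| (level (X m w))%:R - ell0 * m%:R |]).
  apply: bigcup_measurable => m _.
  exact: (measurable_discrete (mX hX m)
    (fun x => dl * m%:R < `| (level x)%:R - ell0 * m%:R |)).
by apply/seteqP; split=> w [m H1 H2]; exists m.
Qed.

Lemma bad_cvg0 dl : 0 < dl ->
  {ae P o, forall w, (fun n => (level (X n w))%:R / n%:R) @ \oo --> ell0} ->
  (fun n => pr (bad dl n)) @ \oo --> 0.
Proof.
move=> dl0 H.
have noninc : {homo bad dl : n m / (n <= m)%N >-> (m <= n)%O}.
  move=> n m nm; apply/subsetPset => w [k mk Hk]; exists k => //.
  exact: leq_trans mk.
have mcap : measurable (\bigcap_n bad dl n).
  by apply: bigcapT_measurable => n; exact: measurable_bad.
have cap0 : P o (\bigcap_n bad dl n) = 0%E.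
  case: H => N [mN PN HN]; apply/eqP; rewrite eq_le measure_ge0 andbT -PN.
  apply: le_measure; rewrite ?inE // => w bw; apply: HN => /= cw.
  have /cvgrPdist_le/(_ _ dl0)[n _ Hn] := cw.
  (* The index [n.+1] forces [m > 0], so that division by [m] is legitimate. *)
  have [m nm] := bw n.+1 I; apply/negP; rewrite -leNgt.
  have m0 : 0 < m%:R :> R by rewrite ltr0n; apply: leq_trans nm.
  have eqm : `|(level (X m w))%:R - ell0 * m%:R| =
      `|ell0 - (level (X m w))%:R / m%:R| * m%:R :> R.
    rewrite -[X in _ = _ * X](ger0_norm (ltW m0)) -normrM mulrBl divfK ?gt_eqF //.
    by rewrite distrC.
  by rewrite eqm ler_pM2r //; exact: Hn m (ltnW nm).
have H1 : (fun n => P o (bad dl n)) @ \oo --> P o (\bigcap_n bad dl n).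
  apply: (@nonincreasing_cvg_mu _ _ _ (P o) (bad dl)) => //.
    by rewrite -ge0_fin_numE // fin_num_measure //; exact: measurable_bad.
  exact: measurable_bad.
by rewrite cap0 in H1; exact: fine_cvg H1.
Qed.

Lemma step_anc x y L :
  [\/ is_child x y, is_child y x | x = o /\ y = o] ->
  (L <= level x)%N -> (L <= level y)%N -> anc L x = anc L y.
Proof.
case=> [xy Lx _|yx _ Ly|[-> ->] //].
  move/level_child: (xy) => lv; case/andP: xy => _ /eqP <-.
  by rewrite parent_anc anc_anc // lv.
move/level_child: (yx) => lv; case/andP: yx => _ /eqP <-.
by rewrite parent_anc anc_anc // lv.
Qed.

(** In a tree, a nearest neighbour path can change its ancestor at level [L] only by passing below
    level [L]. *)
Lemma good_anc w L n N :
  (forall n, [\/ is_child (X n w) (X n.+1 w), is_child (X n.+1 w) (X n w) |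
     X n w = o /\ X n.+1 w = o]) ->
  (forall m, (n <= m)%N -> (L <= level (X m w))%N) -> (n <= N)%N ->
  anc L (X N w) = anc L (X n w).
Proof.
move=> adj lvl; elim: N => [|N IH]; first by rewrite leqn0 => /eqP ->.
rewrite leq_eqVlt => /predU1P[<- //|]; rewrite ltnS => nN.
rewrite -IH //; apply/esym/step_anc; [exact: adj|exact: lvl|].
by apply: lvl; exact: leqW.
Qed.

Lemma not_bad_level w dl n L : ~ bad dl n w -> 0 < dl -> 0 <= ell0 - dl ->
  L%:R <= (ell0 - dl) * n%:R ->
  (forall m, (n <= m)%N -> (L <= level (X m w))%N) /\
  (level (X n w))%:R <= (ell0 + dl) * n%:R.
Proof.
move=> nbad dl0 el Ln.
have H m : (n <= m)%N -> `| (level (X m w))%:R - ell0 * m%:R | <= dl * m%:R.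
  by move=> nm; rewrite leNgt; apply/negP => h; apply: nbad; exists m.
split=> [m nm|].
  rewrite -(ler_nat R); apply: (le_trans Ln).
  apply: (@le_trans _ _ ((ell0 - dl) * m%:R)); first by rewrite ler_wpM2l // ler_nat.
  by have := H m nm; rewrite ler_distlC mulrBl; lra.
by have := H n (leqnn n); rewrite ler_distlC mulrDl; lra.
Qed.

Local Notation c := (- ln (code_base R D)).

Lemma c_ge0 : 0 <= c.
Proof. by rewrite oppr_ge0 ln_le0 // ltW // code_base_lt1. Qed.

Lemma theta0_sum n : \sum_(x <- tball n) theta R D 0 x <= 1.
Proof.
have := sum_theta nbE nb_uniq R nbD 0 o n; rewrite add0n.
rewrite (eq_bigl xpredT); last first.
  move=> x; rewrite /= -val_eqE /= take0 //.
move=> /le_trans; apply; rewrite gerBl exprn_ge0 //.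
Qed.

(** * Encoding the walk and its later ancestor by each other *)

Section levels.
Variables (dl : R) (n N L : nat).
Hypothesis dl0 : 0 < dl.
Hypothesis el : 0 <= ell0 - dl.
Hypothesis Ln : L%:R <= (ell0 - dl) * n%:R.
Hypothesis nN : (n <= N)%N.

Let J (a b : T) := pr ([set w | X n w = a] `&` [set w | anc L (X N w) = b]).
Let Jbad (a b : T) :=
  pr (bad dl n `&` [set w | X n w = a] `&` [set w | anc L (X N w) = b]).
Let good (a b : T) := [&& anc L a == b, (L <= level a)%N &
   (level a)%:R <= (ell0 + dl) * n%:R].

Let mW a : measurable [set w | X n w = a]. Proof. exact: mX hX _ _. Qed.
Let mA b : measurable [set w | anc L (X N w) = b].
Proof. exact: measurable_anc hX _ _ _. Qed.

Let J0 a b : 0 <= J a b. Proof. exact: pr_ge0. Qed.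

Let JsumB a : \sum_(b <- tball L) J a b = walk_law n a.
Proof.
by rewrite -pr_fibers_anc //; rewrite (walk_law_prob nbE nb_uniq hX).
Qed.

Let JsumA b : \sum_(a <- tball n) J a b = pr [set w | anc L (X N w) = b].
Proof.
rewrite (pr_fibers_walk n (mA b)); apply: eq_bigr => a _.
by rewrite /J setIC.
Qed.

Let Jsum : \sum_(a <- tball n) \sum_(b <- tball L) J a b = 1.
Proof.
under eq_bigr do rewrite JsumB.
by rewrite (walk_law_sum nbE nb_uniq hX).
Qed.

Let Jbadsum : \sum_(a <- tball n) \sum_(b <- tball L) Jbad a b = pr (bad dl n).
Proof.
have mB := measurable_bad dl n.
rewrite (pr_fibers_walk n mB); apply: eq_bigr => a _.
by rewrite -pr_fibers_anc //; exact: measurableI.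
Qed.

(** Off the bad event almost every trajectory yields a good pair, so the mass of any other pair
    comes from the bad event alone. *)
Let J_bad a b : ~~ good a b -> J a b <= Jbad a b.
Proof.
move=> ngood; rewrite -lee_fin -!prE; [|by do !apply: measurableI => //; exact: measurable_bad|exact: measurableI].
apply: (ae_le_prob (A := _ `&` _)); first exact: measurableI.
  by do !apply: measurableI => //; exact: measurable_bad.
apply: filterS (ae_adj nbE nb_uniq pfwd0 pback0 hX) => w adj [/= Xa Xb].
split=> //; split=> //; apply: contrapT => nbad.
have [lvl up] := not_bad_level nbad dl0 el Ln.
move/negP: ngood; apply; rewrite /good -Xa up lvl // -Xb.
by rewrite (good_anc adj lvl nN) eqxx.
Qed.

(** A good pair is charged [ln 2 + W1] and any other pair [ln 2 + W2]; by [J_bad] the latter have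
    total mass at most [pr (bad dl n)]. *)
Let code_bound (kappa : T -> T -> R) W1 W2 : 0 <= W1 -> 0 <= W2 ->
  (forall a b, a \in tball n -> b \in tball L -> good a b -> - ln (kappa a b) <= ln 2 + W1) ->
  (forall a b, a \in tball n -> b \in tball L -> - ln (kappa a b) <= ln 2 + W2) ->
  - (\sum_(a <- tball n) \sum_(b <- tball L) J a b * ln (kappa a b)) <=
  ln 2 + W1 + W2 * pr (bad dl n).
Proof.
move=> W10 W20 H1 H2; rewrite -sumrN.
have -> : ln 2 + W1 + W2 * pr (bad dl n) =
  \sum_(a <- tball n) \sum_(b <- tball L) (J a b * (ln 2 + W1) + Jbad a b * W2).
  under eq_bigr do rewrite big_split -!big_distrl /=.
  rewrite big_split -!big_distrl /= Jbadsum.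
  under eq_bigr do rewrite JsumB.
  by rewrite (walk_law_sum nbE nb_uniq hX) mul1r mulrC.
rewrite big_seq [leRHS]big_seq; apply: ler_sum => a an.
rewrite -sumrN big_seq [leRHS]big_seq; apply: ler_sum => b bL.
rewrite -mulrN; have [g|ng] := boolP (good a b).
  rewrite -[leLHS]addr0 lerD ?mulr_ge0 ?pr_ge0 //.
  by rewrite ler_wpM2l // H1.
apply: (@le_trans _ _ (J a b * (ln 2 + W2))); first by rewrite ler_wpM2l // H2.
rewrite mulrDr mulrDr -addrA lerD2l -[leLHS]add0r lerD ?mulr_ge0 //.
by rewrite ler_wpM2r // J_bad.
Qed.

(** The summand [ln 2] is the price of mixing two codes with weights one half. *)
Let ln_half (k u : R) : 0 < u -> 2^-1 * u <= k -> - ln k <= ln 2 - ln u.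
Proof.
move=> u0 uk; have hu : 0 < 2^-1 * u by rewrite mulr_gt0.
have : ln (2^-1 * u) <= ln k by rewrite ler_ln ?posrE // (lt_le_trans hu).
by rewrite lnM ?posrE // lnV ?posrE //; lra.
Qed.

(** For a good pair the ancestor is a function of [X n], so only the mixing costs [ln 2]; otherwise
    the fallback code of a vertex of level at most [L] is used. *)
Lemma anc_entropy_le : anc_entropy N L <=
  walk_entropy n + ln 2 + (c * L.+1%:R) * pr (bad dl n).
Proof.
(* With probability 1/2 guess [anc L a], otherwise any vertex. *)
pose kappa (a b : T) : R := 2^-1 * (anc L a == b)%:R + 2^-1 * theta R D 0 b.
have th0 b : 0 < 2^-1 * theta R D 0 b by rewrite mulr_gt0 // theta_gt0.
have k0 a b : 0 < kappa a b.
  by rewrite /kappa ltr_wpDl // mulr_ge0.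
have k1 a : a \in tball n -> \sum_(b <- tball L) kappa a b <= 1.
  move=> _; rewrite big_split /= -!big_distrr /=.
  have : \sum_(b <- tball L) (anc L a == b)%:R <= 1 :> R.
    rewrite -natr_sum (_ : (\sum_(b <- tball L) _)%N = count_mem (anc L a) (tball L)).
      by rewrite count_uniq_mem ?tball_uniq // lern1 leq_b1.
    rewrite -sum1_count [RHS]big_mkcond; apply: eq_bigr => b _.
    by rewrite /= eq_sym; case: eqP.
  by have := theta0_sum L; lra.
have := @entropy_coding R _ _ (tball n) (tball L) J kappa J0 k0 Jsum k1.
under eq_bigr do rewrite JsumA; under [X in _ <= X - _]eq_bigr do rewrite JsumB.
move=> /le_trans; apply; rewrite -addrA lerD2l -[ln 2 in leRHS]addr0.
apply: code_bound => //; first by rewrite mulr_ge0 // c_ge0.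
  move=> a b _ _ /and3P[/eqP ab _ _]; rewrite addr0 -[leRHS]subr0 -ln1.
  apply: ln_half => //; rewrite mulr1 /kappa ab eqxx mulr1.
  by rewrite lerDl ltW.
move=> a b _; rewrite mem_tball // => bL.
apply: (@le_trans _ _ (ln 2 - ln (theta R D 0 b))).
  by apply: ln_half; rewrite ?theta_gt0 // /kappa lerDr mulr_ge0.
rewrite lerD2l ln_theta subn0 mulrC; apply: ler_wpM2l; first exact: c_ge0.
by rewrite ler_nat ltnS.
Qed.

(** For a good pair, [X n] is a descendant of the ancestor at most [(ell0 + dl) * n - L] levels
    below it; otherwise the fallback code of a vertex of level at most [n] is used. *)
Lemma walk_entropy_le : walk_entropy n <=
  anc_entropy N L + ln 2 + c * ((ell0 + dl) * n%:R - L%:R + 1) +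
  (c * n.+1%:R) * pr (bad dl n).
Proof.
have cge0 := c_ge0.
have WL : 0 <= (ell0 + dl) * n%:R - L%:R.
  rewrite subr_ge0 (le_trans Ln) // ler_wpM2r //; move: dl0; lra.
(* With probability 1/2 guess a descendant of b, otherwise any vertex. *)
pose kappa (b a : T) : R := 2^-1 * (((L <= level a)%N && (anc L a == b))%:R * theta R D L a)
  + 2^-1 * theta R D 0 a.
have th0 l a : 0 < theta R D l a by exact: theta_gt0.
have k0 b a : 0 < kappa b a.
  by rewrite /kappa ltr_wpDl ?mulr_gt0 // mulr_ge0 // mulr_ge0 // ltW.
have k1 b : b \in tball L -> \sum_(a <- tball n) kappa b a <= 1.
  move=> _; rewrite big_split /= -!big_distrr /=.
  suff : \sum_(a <- tball n) ((L <= level a)%N && (anc L a == b))%:R * theta R D L a <= 1.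
    by have := theta0_sum n; lra.
  have -> : \sum_(a <- tball n) ((L <= level a)%N && (anc L a == b))%:R * theta R D L a =
    \sum_(a <- tball n | (L <= level a)%N && (anc L a == b)) theta R D L a.
    rewrite [RHS]big_mkcond; apply: eq_bigr => a _.
    by case: ifP => _; rewrite ?mul1r ?mul0r.
  have [Ln'|nL] := leqP L n.
    rewrite -(subnKC Ln'); apply: le_trans (sum_theta nbE nb_uniq R nbD L b (n - L)) _.
    by rewrite gerBl exprn_ge0.
  rewrite big_seq_cond big_pred0 // => a; apply/negP => /and3P[an La _].
  by move: an; rewrite mem_tball // leqNgt (leq_trans nL La).
have J0' b a : 0 <= J a b by [].
have Jsum' : \sum_(b <- tball L) \sum_(a <- tball n) J a b = 1.
  by rewrite exchange_big.
have := @entropy_coding R _ _ (tball L) (tball n) (fun b a => J a b) kappa J0' k0 Jsum' k1.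
under eq_bigr do rewrite JsumB; under [X in _ <= X - _]eq_bigr do rewrite JsumA.
rewrite [X in _ - X]exchange_big /=.
move=> /le_trans; apply; rewrite -!addrA lerD2l !addrA.
apply: (code_bound (kappa := fun a b => kappa b a)).
- by rewrite mulr_ge0 // addr_ge0.
- by rewrite mulr_ge0.
- move=> a b _ _ /and3P[/eqP ab La aW].
  apply: (@le_trans _ _ (ln 2 - ln (theta R D L a))).
    apply: ln_half => //; rewrite /kappa ab eqxx La mul1r lerDl.
    by rewrite mulr_ge0 // ltW.
  rewrite lerD2l ln_theta mulrC; apply: ler_wpM2l => //.
  by rewrite -natr1 natrB // lerD2r lerD2r.
- move=> a b an _; apply: (@le_trans _ _ (ln 2 - ln (theta R D 0 a))).
    apply: ln_half => //; rewrite /kappa lerDr.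
    by rewrite mulr_ge0 // mulr_ge0 // ltW.
  rewrite lerD2l ln_theta subn0 mulrC; apply: ler_wpM2l => //.
  by rewrite ler_nat ltnS; move: an; rewrite mem_tball.
Qed.

End levels.
End comparison.

(** * Asymptotics *)

Section asymptotics.
Variables (R : realType) (G : countType) (E : rel G) (i0 : G) (nb : G -> seq G).
Variables (pG : G -> G -> R) (pback : G -> R) (D : nat).
Hypothesis nbE : forall i j, (j \in nb i) = E i j.
Hypothesis nb_uniq : forall i, uniq (nb i).
Hypothesis nbD : forall i, (size (nb i) <= D)%N.
Hypothesis pfwd0 : forall i j, 0 <= pfwd pG pback i j.
Hypothesis pfwdE : forall i j, E i j -> 0 < pfwd pG pback i j.
Hypothesis pfwdN : forall i j, ~~ E i j -> pfwd pG pback i j = 0.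
Variables (e C r : R).
Hypothesis e0 : 0 < e.
Hypothesis eb : forall i, e <= pback i.
Local Notation T := (dcover E i0).
Local Notation o := (cover_root E i0).
Local Notation K := (@walk_kernel R G E i0 pG pback).
Local Notation walk_law := (@walk_law R G E i0 nb pG pback).
Local Notation tball := (tball E i0 nb).
Local Notation lev := (lev E i0 nb).
Hypothesis r01 : 0 < r < 1.
Hypothesis walk_law_geo : forall n, walk_law n o <= C * r ^+ n.
Variables (d : measure_display) (Omega : measurableType d).
Variables (P : T -> probability Omega R) (X : nat -> Omega -> T).
Hypothesis hX : markov_chain K P X.
Hypothesis reprP : forall i, exists2 x : T, x != o & tau x = i.
Local Notation Fb := (@Fback R G E i0 d Omega P X).
Local Notation q := (@exit_kernel R G E i0 pG pback d Omega P X).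
Hypothesis Fb1 : forall i, Fb i <> 1.
Local Notation exit_law := (exit_law nb pG pback P X).
Local Notation pr B := (fine (P o B)).
Local Notation walk_entropy := (@walk_entropy R G E i0 nb pG pback).
Local Notation anc_entropy := (@anc_entropy R G E i0 nb d Omega P X).
Local Notation step := (markov_step nb q).
Variable ell0 : R.
Local Notation bad := (bad X ell0).
Hypothesis hell0 : {ae P o, forall w,
  (fun n => (level (X n w))%:R / n%:R) @ \oo --> ell0}.

Let pback0 i : 0 <= pback i. Proof. exact: le_trans (ltW e0) (eb i). Qed.

Definition level_entropy L : R := \sum_(x <- lev L) eta (exit_law x).

(** A finite sum over [tball L]: the terms of level [L] converge by [subtree_prob_cvg], and those of
    lower level are values of [eta] at probabilities tending to 0. *)
Lemma anc_entropy_cvg L : (0 < L)%N ->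
  (fun N => anc_entropy N L) @ \oo --> level_entropy L.
Proof.
case: L => // L _.
have -> : level_entropy L.+1 = \sum_(b <- tball L.+1)
    (if level b == L.+1 then eta (exit_law b) else eta 0).
  rewrite big_tball big_seq big1 ?add0r; last first.
    by move=> b; rewrite mem_tball // => bL; rewrite ltn_eqF ?eta0.
  by apply: eq_big_seq => b; rewrite mem_lev // => ->.
apply: cvg_sum_seq => b; rewrite mem_tball // => bL.
under eq_fun do rewrite (anc_tree_prob nbE nb_uniq e0 r01 hX) //.
case: eqP => bL1.
  apply: eta_cvg => [N|].
    rewrite fine_ge0 //= -lee_fin -prE ?probability_le1 //.
      exact: measurable_anc hX _ _ _.
    exact: measurable_anc hX _ _ _.
  apply: (subtree_prob_cvg nbE nb_uniq pfwd0 pfwdE e0 eb r01 walk_law_geo hX reprP).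
  by rewrite cover_root_level bL1.
apply: eta_cvg => [N|].
  by rewrite (walk_law_ge0 nb pfwd0 e0 eb) (walk_law_le1 nbE nb_uniq hX).
exact: (walk_law_cvg0 nbE pfwd0 e0 eb r01 walk_law_geo).
Qed.

Local Notation c := (- ln (code_base R D)).

Lemma level_entropy_bounds dl n L : 0 < dl -> 0 <= ell0 - dl -> (0 < L)%N ->
  L%:R <= (ell0 - dl) * n%:R ->
  level_entropy L <= walk_entropy n + ln 2 + (c * L.+1%:R) * pr (bad dl n) /\
  walk_entropy n <= level_entropy L + ln 2 +
    c * ((ell0 + dl) * n%:R - L%:R + 1) + (c * n.+1%:R) * pr (bad dl n).
Proof.
move=> dl0 el L0 Ln; have cv := anc_entropy_cvg L0.
have cl : limn (fun N => anc_entropy N L) = level_entropy L by apply/cvg_lim.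
split.
  rewrite -cl; apply: limr_le; first exact: cvgP cv.
  exists n => // N /= nN.
  exact: (anc_entropy_le nbE nb_uniq nbD pfwd0 pback0 hX dl0 el Ln nN).
rewrite -!addrA -lerBlDr -cl; apply: limr_ge; first exact: cvgP cv.
exists n => // N /= nN; rewrite lerBlDr !addrA.
exact: (walk_entropy_le nbE nb_uniq nbD pfwd0 pback0 hX dl0 el Ln nN).
Qed.

Definition row_entropy i : R := \sum_(j <- nb i) eta (q i j).

Let q0 i j : 0 <= q i j.
Proof. exact: (q_ge0 nbE nb_uniq pfwd0 pfwdE e0 eb r01 walk_law_geo hX reprP). Qed.

Let q1 i : \sum_(j <- nb i) q i j = 1.
Proof. exact: (sum_q nbE nb_uniq pfwd0 pfwdE e0 eb r01 walk_law_geo hX reprP Fb1). Qed.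

Let q_le1 i j : j \in nb i -> q i j <= 1.
Proof.
move=> ij; rewrite -(q1 i) (big_rem j) //= lerDl.
exact: sumr_ge0.
Qed.

Lemma row_entropy_bound i : 0 <= row_entropy i <= 2 * D%:R.
Proof.
rewrite /row_entropy; apply/andP; split.
  rewrite big_seq; apply: sumr_ge0 => j ij.
  by rewrite eta_ge0 // q0 q_le1.
apply: (@le_trans _ _ (\sum_(j <- nb i) 2)).
  rewrite big_seq [leRHS]big_seq; apply: ler_sum => j ij.
  by rewrite eta_le2 // q0 q_le1.
rewrite big_const_seq count_predT iter_addr_0 -[2 *+ _]mulr_natr.
by rewrite ler_wpM2l // ler_nat.
Qed.

Lemma lev_root x L : (0 < L)%N -> x \in lev L -> x != o.
Proof. by rewrite mem_lev // cover_root_level => L0 /eqP ->; rewrite -lt0n. Qed.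

Let exit_lawE x j : x != o -> E (tau x) j -> exit_law (ext x j) = exit_law x * q (tau x) j.
Proof. exact: (exit_law_ext nbE nb_uniq pfwd0 pfwdE e0 eb r01 walk_law_geo hX reprP Fb1). Qed.

Let exit_law0 x : x != o -> 0 < exit_law x.
Proof. exact: (exit_law_gt0 nbE nb_uniq pfwd0 pfwdE e0 eb r01 walk_law_geo hX reprP Fb1). Qed.

Let exit_lawS L : (0 < L)%N -> \sum_(x <- lev L) exit_law x = 1.
Proof. exact: (sum_exit_law nbE nb_uniq pfwd0 pfwdE e0 eb r01 walk_law_geo hX reprP). Qed.

Lemma exit_law_step f L : (0 < L)%N ->
  \sum_(x <- lev L.+1) exit_law x * f (tau x) = \sum_(x <- lev L) exit_law x * step f (tau x).
Proof.
move=> L0; rewrite big_lev; apply: eq_big_seq => x xL.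
have x0 := lev_root L0 xL.
rewrite /markov_step big_distrr /=; apply: eq_big_seq => j; rewrite nbE => xj.
by rewrite exit_lawE // tau_ext // mulrA.
Qed.

Lemma exit_law_iter f m : \sum_(x <- lev m.+1) exit_law x * f (tau x) =
  \sum_(x <- lev 1) exit_law x * iter m step f (tau x).
Proof. by elim: m f => // m IH f; rewrite exit_law_step // IH iterSr. Qed.

(** Chain rule: given the vertex [x] of the ray at level [L], the next one is chosen according to
    row [tau x] of [q]. *)
Lemma level_entropyS L : (0 < L)%N -> level_entropy L.+1 =
  level_entropy L + \sum_(x <- lev L) exit_law x * row_entropy (tau x).
Proof.
move=> L0; rewrite /level_entropy big_lev -big_split /=.
apply: eq_big_seq => x xL; have x0 := lev_root L0 xL.
rewrite (eq_big_seq (fun j => - (exit_law x * ln (exit_law x)) * q (tau x) j +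
   exit_law x * eta (q (tau x) j))).
  by rewrite big_split -!big_distrr /= q1 mulr1.
move=> j; rewrite nbE => xj; rewrite exit_lawE // /eta.
have qj : 0 < q (tau x) j.
  exact: (q_gt0 nbE nb_uniq pfwd0 pfwdE e0 eb r01 walk_law_geo hX reprP Fb1).
by rewrite lnM ?posrE ?exit_law0 //; ring.
Qed.

(** Levels start at 1, since [exit_law] has its meaning only away from the root; from level 1 to
    level [k.+2] there are [k.+1] increments. *)
Lemma level_entropy_average k : level_entropy k.+2 = level_entropy 1 +
  k.+1%:R * \sum_(x <- lev 1) exit_law x * average nb q row_entropy k (tau x).
Proof.
transitivity (level_entropy 1 +
  \sum_(m < k.+1) \sum_(x <- lev m.+1) exit_law x * row_entropy (tau x)).
  elim: k.+1 => [|m IH]; first by rewrite big_ord0 addr0.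
  by rewrite level_entropyS // IH big_ord_recr addrA.
congr (_ + _); under eq_bigr do rewrite exit_law_iter.
rewrite exchange_big /= big_distrr /=; apply: eq_bigr => x _.
rewrite -big_distrr /= /average [RHS]mulrCA; congr (_ * _).
by rewrite mulrA divff // mul1r.
Qed.

Variable nu : G -> R.
Hypothesis nu0 : forall i, 0 <= nu i.
Hypothesis nu1 : (\esum_(i in [set: G]) (nu i)%:E = 1)%E.
Hypothesis nuq : forall j, (\esum_(i in [set: G]) (nu i * q i j)%:E = (nu j)%:E)%E.
Hypothesis hconn : strongly_connected E.

Let q_nb i j : j \notin nb i -> q i j = 0.
Proof.
rewrite nbE => ij; rewrite /exit_kernel.
by rewrite pfwdN // mulr0 mul0r.
Qed.

Let irr i j : exists2 s : seq G,
  path (fun i j => 0 < q i j) i s & last i s = j.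
Proof.
have [s sp sl] := hconn i j; exists s => //.
apply: sub_path sp => a b ab.
exact: (q_gt0 nbE nb_uniq pfwd0 pfwdE e0 eb r01 walk_law_geo hX reprP Fb1).
Qed.

Local Notation Hq := (fine (mean nu row_entropy)).

(** The first label of the ray has the law given by [exit_law] on level 1; convergence from each of
    its finitely many values suffices. *)
Lemma level_average_cvg :
  (fun k => \sum_(x <- lev 1) exit_law x * average nb q row_entropy k (tau x)) @ \oo
    --> Hq.
Proof.
rewrite -[X in _ --> X]mul1r -(exit_lawS (ltn0Sn 0)) big_distrl /=.
apply: cvg_sum_seq => x _; apply: cvgM; first exact: cvg_cst.
exact: (average_cvg q0 nb_uniq q_nb q1 nu0 nu1 nuq irr row_entropy_bound).
Qed.

(** * Positive speed *)

(** Level [m] has at most [D.+1 ^+ m] vertices, each of probability at most [C * r ^+ n / e ^+ m].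
    The 1 added to the base absorbs the sum over levels up to [k]. *)
Lemma small_level_prob n k :
  pr [set w | (level (X n w) <= k)%N] <= C * (1 + D.+1%:R / e) ^+ k * r ^+ n.
Proof.
have C0 : 0 <= C.
  have := walk_law_geo 0; rewrite expr0 mulr1; apply: le_trans.
  exact: (walk_law_ge0 nb pfwd0 e0 eb).
case/andP: r01 => r0 r1.
have mB : measurable [set w | (level (X n w) <= k)%N].
  exact: (measurable_discrete (mX hX n) (fun x => (level x <= k)%N)).
have -> : pr [set w | (level (X n w) <= k)%N] = \sum_(y <- tball k) walk_law n y.
  apply: EFin_inj; rewrite -prE // (@measure_fibers_seq _ _ _ _ _ (mX hX n) _ _ (tball k)) //.
  - rewrite -sumEFin; apply: eq_big_seq => y; rewrite mem_tball // => yk.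
    apply: etrans (walk_law_prob nbE nb_uniq hX _ _); congr (P o _).
    by apply/seteqP; split=> w /= => [[]//|->].
  - exact: tball_uniq.
  - move=> y; rewrite mem_tball // => yk.
    rewrite (_ : _ `&` _ = set0) ?measure0 //.
    by apply/seteqP; split=> w //= [H Xy]; move: yk; rewrite -Xy H.
apply: (@le_trans _ _ (\sum_(y <- tball k) C * r ^+ n * (e^-1) ^+ level y)).
  apply: ler_sum => y _.
  apply: (le_trans (walk_law_geo_at nbE pfwd0 e0 eb walk_law_geo n y)).
  rewrite mulrAC ler_wpM2l ?mulr_ge0 ?exprn_ge0 ?(ltW r0) //.
  by rewrite exprMn ler_piMl ?exprn_ge0 ?invr_ge0 ?(ltW e0) // exprn_ile1 // ltW.
rewrite -big_distrr /= [leRHS]mulrAC ler_wpM2l ?mulr_ge0 ?exprn_ge0 ?(ltW r0) //.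
set g := D.+1%:R / e; have g0 : 0 <= g by rewrite divr_ge0 // ltW.
have levk m : \sum_(y <- lev m) (e^-1) ^+ level y <= g ^+ m.
  rewrite (eq_big_seq (fun=> 1 * (e^-1) ^+ m)).
    rewrite -big_distrl /= /g exprMn ler_wpM2r ?exprn_ge0 ?invr_ge0 ?(ltW e0) //.
    have := card_lev_anc nbE nb_uniq R nbD 0 o m; rewrite add0n.
    apply: le_trans; rewrite [leRHS]big_mkcond; apply: ler_sum => x _.
    by rewrite (_ : anc 0 x = o) ?eqxx //; apply: val_inj; rewrite /= take0.
  by move=> x; rewrite mem_lev // mul1r => /eqP ->.
elim: k {mB} => [|k IH]; first by have := levk 0%N; rewrite !expr0.
rewrite big_tball exprS mulrDl mul1r; apply: lerD => //.
apply: (le_trans (levk _)); rewrite exprS ler_wpM2l // lerXn2r ?nnegrE ?addr_ge0 //.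
by rewrite lerDr.
Qed.

(** Choose [m] so that [k] is a small enough fraction of the time [m.+1 * k] for [small_level_prob]
    to give a bound [C * 2^-1 ^+ k]. If [ell0 <= 0], the walk is at level at most [k] off the bad
    event, and both probabilities tend to 0. *)
Lemma ell0_gt0 : 0 < ell0.
Proof.
case/andP: r01 => r0 r1.
set g := 1 + D.+1%:R / e; have g0 : 0 < g.
  by rewrite ltr_pwDl // divr_ge0 // ltW.
have [m mg] : exists m, g * r ^+ m.+1 <= 2^-1.
  have : (fun m => g * r ^+ m) @ \oo --> g * 0.
    apply: cvgM; first exact: cvg_cst.
    by apply: cvg_expr; rewrite ger0_norm // ltW.
  rewrite mulr0 => /cvgrPdist_le/(_ (2^-1))[] // m _ Hm.
  exists m; have /= := Hm m.+1 (leqnSn m).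
  by rewrite sub0r normrN; apply: le_trans; exact: ler_norm.
rewrite ltNge; apply/negP => l0.
(* Chosen so that [(ell0 + dl) * (m.+1 * k) = k]. *)
pose dl := m.+1%:R^-1 - ell0.
have dl0 : 0 < dl by rewrite subr_gt0 (le_lt_trans l0) // invr_gt0.
have bc := bad_cvg0 hX dl0 hell0.
have small k : 1 <= pr (bad dl (m.+1 * k)) + C * 2^-1 ^+ k.
  have mB := measurable_bad hX ell0 dl (m.+1 * k).
  have := @probability_setC _ _ _ (P o) _ mB.
  have C0 : 0 <= C.
    have := walk_law_geo 0; rewrite expr0 mulr1; apply: le_trans.
    exact: (walk_law_ge0 nb pfwd0 e0 eb).
  have mS : measurable [set w | (level (X (m.+1 * k) w) <= k)%N].
    exact: (measurable_discrete (mX hX (m.+1 * k)) (fun x => (level x <= k)%N)).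
  rewrite prE; last exact: measurableC.
  rewrite [P o (bad _ _)]prE // -EFinB => -[] hc.
  suff : pr (~` bad dl (m.+1 * k)) <= C * 2^-1 ^+ k by rewrite hc; lra.
  apply: (@le_trans _ _ (pr [set w | (level (X (m.+1 * k) w) <= k)%N])).
    rewrite -lee_fin -!prE //; last exact: measurableC.
    apply: le_measure; rewrite ?inE //; first exact: measurableC.
    move=> w nbad /=; have : ~ dl * (m.+1 * k)%:R <
        `| (level (X (m.+1 * k) w))%:R - ell0 * (m.+1 * k)%:R |.
      by move=> h; apply: nbad; exists (m.+1 * k)%N.
    move/negP; rewrite -leNgt ler_distl => /andP[_].
    rewrite -mulrDl addrC subrK natrM mulrA mulVf // mul1r.
    by rewrite ler_nat.
  apply: (le_trans (small_level_prob _ _)); rewrite -/g -mulrA ler_wpM2l //.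
  rewrite exprM -exprMn lerXn2r ?nnegrE //.
  by rewrite mulr_ge0 ?exprn_ge0 // ltW.
have mk : (fun k => (m.+1 * k)%N) @ \oo --> \oo.
  by apply/cvgnyPge => M; exists M => // n /= Mn; rewrite mulSn (leq_trans Mn) // leq_addr.
have cvs : (fun k => pr (bad dl (m.+1 * k)) + C * 2^-1 ^+ k) @ \oo --> 0 + C * 0.
  apply: cvgD; first exact: (cvg_comp _ _ mk bc).
  apply: cvgM; first exact: cvg_cst.
  by apply: cvg_expr; rewrite ger0_norm // invf_lt1 // ltr1n.
have : 1 <= limn (fun k => pr (bad dl (m.+1 * k)) + C * 2^-1 ^+ k).
  by apply: limr_ge; [exact: cvgP cvs|exact: nearW].
by rewrite (cvg_lim _ cvs) // mulr0 addr0 ler10.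
Qed.

Let cvg_invn : (fun n => n%:R^-1 : R) @ \oo --> (0 : R).
Proof. by rewrite -cvg_shiftS; exact: cvg_harmonic. Qed.

Lemma Hq_ge0 : 0 <= Hq.
Proof.
apply: fine_ge0; apply: mean_ge0 => // i.
by case/andP: (row_entropy_bound i).
Qed.

(** Take [L] to be the integer part of [(ell0 - dl) * n]. The error has three sources: [Hq * dl]
    from stopping at level [L], [2 * c * dl] from the levels between [L] and [(ell0 + dl) * n], and
    [dl] for passing to the limit in [n]. *)
Lemma walk_entropy_near dl : 0 < dl < ell0 -> \forall n \near \oo,
  `| ell0 * Hq - walk_entropy n / n%:R | <= (Hq + 2 * c + 1) * dl.
Proof.
case/andP=> dl0 dle; set s := ell0 - dl; have s0 : 0 < s by rewrite subr_gt0.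
pose L n := Num.truncn (s * n%:R).
have Lb n : (L n)%:R <= s * n%:R < (L n).+1%:R.
  by apply: truncn_itv; rewrite mulr_ge0 // ltW.
pose u n : R := n%:R^-1; pose v n : R := (L n)%:R * u n.
pose be n : R := pr (bad dl n).
pose a k := \sum_(x <- lev 1) exit_law x * average nb q row_entropy k (tau x).
have cu : u @ \oo --> (0 : R) := cvg_invn.
have cbe : be @ \oo --> (0 : R) by exact: (bad_cvg0 hX dl0 hell0).
have cv : v @ \oo --> s.
  apply: (@squeeze_cvgr _ _ _ _ (fun n => s - u n) (fun=> s)).
  - exists 1%N => // n /= n1; rewrite /v /u.
    have n0 : 0 < n%:R :> R by rewrite ltr0n.
    have /andP[h1 h2] := Lb n; rewrite ler_pdivrMr // h1 andbT.
    rewrite ler_pdivlMr // mulrBl mulVf ?gt_eqF //.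
    by move: h2; rewrite -natr1; lra.
  - by rewrite -[X in _ --> X]subr0; apply: cvgB => //; exact: cvg_cst.
  - exact: cvg_cst.
have cL : L @ \oo --> \oo.
  apply/cvgnyPge => M; exists (Num.truncn (M%:R / s)).+1 => // n /= Mn.
  have : M%:R / s < n%:R.
    have /andP[_ h] : (Num.truncn (M%:R / s))%:R <= M%:R / s < (Num.truncn (M%:R / s)).+1%:R.
      by apply: truncn_itv; rewrite divr_ge0 // ltW.
    by apply: lt_le_trans h _; rewrite ler_nat.
  rewrite ltr_pdivrMr // mulrC => h; have /andP[_ h2] := Lb n.
  by rewrite -ltnS -(ltr_nat R); apply: lt_trans h2.
have cL2 : (fun n => (L n - 2)%N) @ \oo --> \oo.
  move/cvgnyPge: cL => H; apply/cvgnyPge => M.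
  by have [m _ Hm] := H M.+2; exists m => // n /Hm /= h; lia.
have ca : (fun n => a (L n - 2)%N) @ \oo --> Hq.
  exact: (cvg_comp _ _ cL2 level_average_cvg).
(* By [level_entropy_average] with [k = L n - 2], this is [level_entropy (L n) / n] as soon as
   [2 <= L n]. *)
pose l n := level_entropy 1 * u n + (v n - u n) * a (L n - 2)%N.
have cl : l @ \oo --> level_entropy 1 * 0 + (s - 0) * Hq.
  apply: cvgD; first by apply: cvgM => //; exact: cvg_cst.
  by apply: cvgM => //; exact: cvgB.
rewrite mulr0 add0r subr0 in cl.
pose Up n := l n + ln 2 * u n + c * ((ell0 + dl) - v n + u n) + c * (1 + u n) * be n.
have cUp : Up @ \oo --> s * Hq + ln 2 * 0 + c * ((ell0 + dl) - s + 0) + c * (1 + 0) * 0.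
  apply: cvgD; first apply: cvgD; first apply: cvgD => //.
  - by apply: cvgM => //; exact: cvg_cst.
  - apply: cvgM; first exact: cvg_cst.
    by apply: cvgD => //; apply: cvgB => //; exact: cvg_cst.
  - apply: cvgM => //; apply: cvgM; first exact: cvg_cst.
    by apply: cvgD => //; exact: cvg_cst.
pose Lo n := l n - ln 2 * u n - c * (v n + u n) * be n.
have cLo : Lo @ \oo --> s * Hq - ln 2 * 0 - c * (s + 0) * 0.
  apply: cvgB; first apply: cvgB => //.
  - by apply: cvgM => //; exact: cvg_cst.
  - apply: cvgM => //; apply: cvgM; first exact: cvg_cst.
    exact: cvgD.
have bounds : \forall n \near \oo, Lo n <= walk_entropy n / n%:R <= Up n.
  move/cvgnyPge: cL => /(_ 2%N) [m _ Hm]; exists m.+1 => // n /= mn.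
  have L2 : (2 <= L n)%N by exact: Hm n (ltnW mn).
  have n0 : 0 < n%:R :> R by rewrite ltr0n; exact: leq_trans mn.
  have /andP[Ls _] := Lb n.
  have [b1 b2] := level_entropy_bounds dl0 (ltW s0) (ltnW L2) Ls.
  have un : n%:R * u n = 1 by rewrite divff ?gt_eqF.
  have vn : n%:R * v n = (L n)%:R by rewrite /v mulrCA un mulr1.
  have lE : n%:R * l n = level_entropy (L n).
    have Ln2 : L n = (L n - 2).+2 by rewrite -addn2 subnK.
    rewrite [in RHS]Ln2 level_entropy_average -/(a _) /l mulrDr mulrCA un mulr1.
    rewrite mulrA mulrBr un vn; congr (_ + _ * _).
    by rewrite {1}Ln2 -natr1 addrK.
  have -> : walk_entropy n / n%:R = u n * walk_entropy n by rewrite mulrC.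
  have cge := c_ge0 R D.
  rewrite -(ler_pM2l n0) -[X in _ && X](ler_pM2l n0) mulrA un mul1r.
  apply/andP; split.
    have -> : n%:R * Lo n = n%:R * l n - ln 2 * (n%:R * u n) -
        c * (n%:R * v n + n%:R * u n) * be n by rewrite /Lo; ring.
    by rewrite lE un vn natr1; move: b1; rewrite /be; lra.
  have -> : n%:R * Up n = n%:R * l n + ln 2 * (n%:R * u n) +
      c * ((ell0 + dl) * n%:R - n%:R * v n + n%:R * u n) +
      c * (n%:R + n%:R * u n) * be n by rewrite /Up; ring.
  by rewrite lE un vn natr1; move: b2; rewrite /be; lra.
have Hq0 := Hq_ge0.
have dl1 : 0 < dl by [].
move/cvgrPdist_le: cUp => /(_ _ dl1) HU; move/cvgrPdist_le: cLo => /(_ _ dl1) HL.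
near=> n.
have /andP[b1 b2] : Lo n <= walk_entropy n / n%:R <= Up n by near: n.
have : `|s * Hq + ln 2 * 0 + c * ((ell0 + dl) - s + 0) + c * (1 + 0) * 0 - Up n| <= dl.
  by near: n.
have : `|s * Hq - ln 2 * 0 - c * (s + 0) * 0 - Lo n| <= dl by near: n.
rewrite !mulr0 !addr0 !subr0 !ler_distl => /andP[h1 h2] /andP[h3 h4].
have -> : (Hq + 2 * c + 1) * dl = Hq * dl + c * (dl + dl) + dl by ring.
have e1 : s * Hq = ell0 * Hq - Hq * dl by rewrite /s; ring.
have e2 : c * (ell0 + dl - s) = c * (dl + dl) by rewrite /s; congr (_ * _); ring.
have cd : 0 <= c * (dl + dl) by rewrite mulr_ge0 ?c_ge0 // addr_ge0 // ltW.
have hd : 0 <= Hq * dl by rewrite mulr_ge0 // ltW.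
by apply/andP; split; lra.
Unshelve. all: by end_near.
Qed.

Lemma walk_entropy_cvg : (fun n => walk_entropy n / n%:R) @ \oo --> ell0 * Hq.
Proof.
have l0 := ell0_gt0; have Hq0 := Hq_ge0; have cge := c_ge0 R D.
apply/cvgrPdist_le => ep ep0.
have M0 : 0 < Hq + 2 * c + 1 by rewrite ltr_wpDl // addr_ge0 // mulr_ge0.
pose dl := Num.min (ell0 / 2) (ep / (Hq + 2 * c + 1)).
have dl0 : 0 < dl < ell0.
  rewrite lt_min gt_min !divr_gt0 //=; apply/orP; left.
  by rewrite ltr_pdivrMr // ltr_pMr // ltr1n.
apply: filterS (walk_entropy_near dl0) => n /le_trans; apply.
by rewrite mulrC -ler_pdivlMr // /dl ge_min lexx orbT.
Qed.

Lemma expectation_ln_law n :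
  ('E_(P o)[fun w => ln (law_at P X o n (X n w))] = (- walk_entropy n)%:E)%E.
Proof.
have mX n' y := mX hX n' y.
have -> : (fun w => ln (law_at P X o n (X n w))) =
    (fun w => \sum_(y <- tball n) ln (walk_law n y) * \1_[set w | X n w = y] w).
  apply/funext => w; rewrite (law_atE nbE nb_uniq hX).
  have [Xb|Xb] := boolP (X n w \in tball n).
    rewrite (bigD1_seq (X n w)) ?tball_uniq //= indicE mem_set // mulr1.
    rewrite big1 ?addr0 // => y yX; rewrite indicE memNset ?mulr0 //.
    by move=> /= e1; rewrite e1 eqxx in yX.
  (* Outside [tball n] the law vanishes and [ln 0] is 0, in agreement with a sum whose indicators
     all vanish. *)
  rewrite walk_law_level; last by move: Xb; rewrite mem_tball // -ltnNge.
    rewrite ln0 // big_seq big1 // => y yb; rewrite indicE memNset ?mulr0 //.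
    by move=> /= e1; rewrite e1 yb in Xb.
  exact: nbE.
rewrite unlock.
under eq_integral do rewrite -sumEFin.
rewrite integral_sum //; last first.
  move=> y; under eq_fun do rewrite EFinM.
  by apply: integrableZl => //; exact: integrable_indic.
rewrite /walk_entropy -sumrN -sumEFin; apply: eq_bigr => y _.
under eq_integral do rewrite EFinM.
rewrite integralZl //; last exact: integrable_indic.
rewrite integral_indic // setIT.
transitivity ((ln (walk_law n y))%:E * (walk_law n y)%:E)%E.
  by congr (_ * _)%E; apply: etrans (walk_law_prob nbE nb_uniq hX n y) _.
by rewrite -EFinM /eta opprK mulrC.
Qed.

End asymptotics.

(** * From the hypotheses of the theorem to those of the sections *)

Lemma out_neighbours (G : countType) (E : rel G) : bounded_geometry E ->
  exists (D : nat) (nb : G -> seq G), forall i,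
    [/\ forall j, (j \in nb i) = E i j, uniq (nb i) & (size (nb i) <= D)%N].
Proof.
case=> D HD; exists D.
suff /choice[nb nbP] : forall i, exists s : seq G,
    [/\ forall j, (j \in s) = E i j, uniq s & (size s <= D)%N] by exists nb.
move=> i; have [s sD sP] := HD i; exists (undup (seq.filter (E i) s)).
split; last 1 first.
- by rewrite (leq_trans (size_undup _)) // (leq_trans _ sD) // size_filter count_size.
- move=> j; rewrite mem_undup mem_filter; case ij : (E i j) => //=.
  by apply: sP; rewrite ij.
- exact: undup_uniq.
Qed.

Lemma first_passage_eq0 (R : realType) (S : choiceType) (q : S -> S -> R) i j n :
  (forall k, q i k = 0) -> first_passage q j n i = 0%E.
Proof.
move=> q0; case: n => // -[|n] /=; first by rewrite q0.
by apply: esum1 => k _; rewrite q0 mul0e.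
Qed.

(** Rows of [pG] sum to 1, so [i0] has an out-edge; a path made of this edge and of a connection to
    [i] is nonempty, which covers [i = i0] as well. *)
Lemma label_off_root (R : realType) (G : countType) (E : rel G) (i0 : G)
    (pG : G -> G -> R) : strongly_connected E -> stochastic pG ->
  (forall i j, (0 < pG i j) = E i j) ->
  forall i, exists2 x : dcover E i0, x != cover_root E i0 & tau x = i.
Proof.
move=> hconn [pG0 pG1] pGE i.
have [j ij] : exists j, E i0 j.
  apply: contrapT => /forallNP noE; have := pG1 i0.
  rewrite esum1 => [/eqP|j _]; first by rewrite eq_sym onee_eq0.
  congr EFin; apply/eqP; rewrite eq_le pG0 andbT leNgt pGE.
  exact/negP.
have [s sp sl] := hconn j i.
have pth : path E i0 (j :: s) by rewrite /= ij.
by exists (exist (fun s => path E i0 s) (j :: s) pth).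
Qed.

(** Positivity is stated under branching: if every vertex has a single successor, each row of Q is a
    point mass and the entropy sum is 0. *)
Theorem theorem3p9 (R : realType) (G : countType) (E : rel G) (i0 : G)
  (pG : G -> G -> R) (pback : G -> R) (eps eps0 : R)
  (d : measure_display) (Omega : measurableType d)
  (P : dcover E i0 -> probability Omega R) (X : nat -> Omega -> dcover E i0)
  (nu : G -> R) (ell0 : R)
  (hconn : strongly_connected E)
  (hgeom : bounded_geometry E)
  (hpG : stochastic pG)
  (hpGE : forall i j, (0 < pG i j) = E i j)
  (heps : 0 < eps < 1)
  (hpback : forall i, eps < pback i < 1 - eps)
  (hX : markov_chain (walk_kernel pG pback) P X)
  (htrans : transient P X)
  (heps0 : 0 < eps0)
  (hbelow : forall x y : dcover E i0, 0 < walk_kernel pG pback x y ->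
     eps0 <= walk_kernel pG pback x y)
  (hpos : positive_recurrent (exit_kernel pG pback P X))
  (hnu : invariant_probability (exit_kernel pG pback P X) nu)
  (hspec : (spectral_radius P X (cover_root E i0) < 1)%E)
  (hell0 : {ae P (cover_root E i0), forall w,
     (fun n => (level (X n w))%:R / n%:R) @ \oo --> ell0}) :
  exists h : R,
    [/\ (fun n => (- (n%:R^-1)%:E *
           'E_(P (cover_root E i0))[fun w => ln (law_at P X (cover_root E i0) n (X n w))])%E)
          @ \oo --> h%:E,
        (h%:E = ell0%:E * \esum_(ij in [set: G * G])
           (- nu ij.1 * exit_kernel pG pback P X ij.1 ij.2
              * ln (exit_kernel pG pback P X ij.1 ij.2))%:E)%E &
        (exists i j k, [/\ E i j, E i k & j != k]) -> 0 < h].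
Proof.
have [D [nb nbP]] := out_neighbours hgeom.
have nbE i j : (j \in nb i) = E i j by case: (nbP i).
have nb_uniq i : uniq (nb i) by case: (nbP i).
have nbD i : (size (nb i) <= D)%N by case: (nbP i).
have e0 : 0 < eps by case/andP: heps.
have eb i : eps <= pback i by case/andP: (hpback i) => /ltW.
have fwd i : 0 < 1 - pback i by case/andP: (hpback i); lra.
have pfwdE i j : E i j -> 0 < pfwd pG pback i j.
  by rewrite -hpGE => ij; rewrite mulr_gt0.
have pfwdN i j : ~~ E i j -> pfwd pG pback i j = 0.
  rewrite -hpGE -leNgt => ij; rewrite /pfwd (_ : pG i j = 0) ?mulr0 //.
  by apply/eqP; rewrite eq_le ij; case: hpG => ->.
have pfwd0 i j : 0 <= pfwd pG pback i j.
  by case: hpG => H _; rewrite mulr_ge0 // ltW.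
have reprP := label_off_root i0 hconn hpG hpGE.
have [C [r [_ r01 geo]]] := spectral_bound (fun n => fine_ge0 (measure_ge0 _ _)) hspec.
have walk_law_geo n : walk_law nb pG pback n (cover_root E i0) <= C * r ^+ n.
  by rewrite -(law_atE nbE nb_uniq hX); exact: geo.
set q := exit_kernel pG pback P X in hpos hnu *.
(* If F(-i) were 1, the convention [0^-1 = 0] would make row [i] of [q] vanish, and the return
   probability to [i] would be 0 instead of 1. *)
have Fb1 i : Fback P X i <> 1.
  move=> F1; have [] := hpos i; rewrite eseries0 => [/eqP|n _ _].
    by rewrite eq_sym onee_eq0.
  apply: first_passage_eq0 => j.
  by rewrite /q /exit_kernel F1 subrr invr0 mulr0 !mul0r.
have [nu0 nu1 nuq] := hnu.
have q0 i j : 0 <= q i j.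
  exact: (q_ge0 nbE nb_uniq pfwd0 pfwdE e0 eb r01 walk_law_geo hX reprP).
have qE i j : E i j -> 0 < q i j.
  exact: (q_gt0 nbE nb_uniq pfwd0 pfwdE e0 eb r01 walk_law_geo hX reprP Fb1).
have q1 i : \sum_(j <- nb i) q i j = 1.
  exact: (sum_q nbE nb_uniq pfwd0 pfwdE e0 eb r01 walk_law_geo hX reprP Fb1).
have q_nb i j : j \notin nb i -> q i j = 0.
  by rewrite nbE => ij; rewrite /q /exit_kernel pfwdN // mulr0 mul0r.
have qle1 i j : q i j <= 1.
  have [ij|/q_nb -> //] := boolP (j \in nb i).
  by rewrite -(q1 i) (big_rem j) //= lerDl sumr_ge0.
have eta0 i j : 0 <= eta (q i j) by rewrite eta_ge0 // q0 qle1.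
set re := row_entropy nb pG pback P X.
have reE : forall i, re i = \sum_(j <- nb i) eta (q i j) by [].
have reB : forall i, 0 <= re i <= 2 * D%:R.
  exact: (row_entropy_bound nbE nb_uniq nbD pfwd0 pfwdE e0 eb r01 walk_law_geo hX reprP Fb1).
have re0 i : 0 <= re i by case/andP: (reB i).
have D0 : 0 <= 2 * D%:R :> R by rewrite mulr_ge0.
have meanf : mean nu re \is a fin_num by exact: (mean_fin nu0 nu1 D0 reB).
have l0 : 0 < ell0.
  exact: (ell0_gt0 nbE nb_uniq nbD pfwd0 e0 eb r01 walk_law_geo hX hell0).
exists (ell0 * fine (mean nu re)); split.
- rewrite (_ : (fun n => _) = EFin \o
      (fun n => walk_entropy E i0 nb pG pback n / n%:R)).
    apply: cvg_EFin; first exact: nearW.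
    exact: (walk_entropy_cvg nbE nb_uniq nbD pfwd0 pfwdE pfwdN e0 eb r01 walk_law_geo
      hX reprP Fb1 hell0 nu0 nu1 nuq hconn).
  apply/funext => n; rewrite (expectation_ln_law nbE nb_uniq hX) /=.
  by rewrite -EFinM mulrNN mulrC.
- have tE i j : - nu i * q i j * ln (q i j) = nu i * eta (q i j).
    by rewrite /eta; ring.
  rewrite EFinM fineK //; congr (_ * _)%E; rewrite /mean.
  have -> : [set: G * G] = [set: G] `*`` (fun=> [set: G]).
    by apply/seteqP; split.
  rewrite -(@esum_esum _ _ _ _ _ (fun i j => (- nu i * q i j * ln (q i j))%:E)).
    apply: eq_esum => i _; rewrite (@esum_seq _ _ (nb i)) //.
    + rewrite reE big_distrr /= -sumEFin; apply: eq_bigr => j _.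
      by rewrite tE.
    + by move=> j; rewrite lee_fin tE mulr_ge0.
    + by move=> j /q_nb ->; rewrite mulr0 mul0r.
  by move=> i j _ _; rewrite lee_fin tE mulr_ge0.
- case=> i [j [k [ij ik jk]]]; rewrite mulr_gt0 // fine_gt0 //.
  rewrite -ge0_fin_numE ?meanf ?andbT; last exact: mean_ge0.
  have irr a b : exists2 s : seq G, path (fun i j => 0 < q i j) a s & last a s = b.
    have [s sp sl] := hconn a b; exists s => //.
    by apply: sub_path sp => u v; exact: qE.
  apply: lt_le_trans (le_mean_at nu0 i re0).
  rewrite lte_fin mulr_gt0 ?(nu_gt0 q0 nu0 nu1 nuq irr) // reE.
  (* The second out-edge of [i] takes a positive share of the row sum 1, so the term [eta (q i j)]
     is strictly positive. *)
  have qij1 : q i j < 1.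
    rewrite -(q1 i) (big_rem j) ?nbE //= ltrDl (big_rem k) /=; last first.
      by rewrite mem_rem_uniq // inE eq_sym jk nbE.
    by rewrite ltr_wpDr ?qE // sumr_ge0.
  rewrite (big_rem j) ?nbE //= ltr_wpDr ?sumr_ge0 // eta_gt0 //.
  by rewrite qij1 qE.
Qed.
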